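(* Let $H$ be an infinite-dimensional separable complex Hilbert space and let $A \in C([0,1], L(H))$ be such that $0\in \operatorname{Int} W_e(A(t))$ for all $t\in [0,1]$. Let $Z$ be a separable Hilbert space, and let $D \in C([0,1], L(Z))$ satisfy \[ \max_{t\in [0,1]}\|D(t)\|<\min_{t\in [0,1]}\operatorname{dist} \bigl(0,\partial W_e(A(t))\bigr). \] Then there exists $S \in C([0,1], L(Z,H))$ such that $S(t)$ is an isometry for every $t\in[0,1]$ and \[ S^*(t)A(t)S(t)=D(t), \qquad t\in [0,1]. \]
   Context: All Hilbert spaces are complex and separable; subspaces are closed. $L(K,H)$ denotes the bounded linear operators from $K$ to $H$, $L(H)=L(H,H)$, and $C([0,1],X)$ denotes the norm-continuous functions $[0,1]\to X$ for a Banach space $X$. For $T\in L(H)$ the essential numerical range $W_e(T)$ is the set of all $\lambda\in\mathbb C$ for which there is an orthonormal sequence $(u_n)$ in $H$ with $\langle Tu_n,u_n\rangle\to\lambda$; it is a nonempty compact convex subset of $\mathbb C$. $\operatorname{Int}$ and $\partial$ denote the interior and the boundary in $\mathbb C$. *)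

(* Defs.v *)
From HB Require Import structures.
From mathcomp Require Import all_boot all_order all_algebra.
From mathcomp Require Import boolp classical_sets reals.
From mathcomp Require Import complex.
Set Implicit Arguments. Unset Strict Implicit. Unset Printing Implicit Defensive.
Import Order.TTheory GRing.Theory Num.Theory.
Local Open Scope ring_scope.
Local Open Scope classical_set_scope.

Section HilbertDefs.
Variable R : realType.
Local Notation C := (R[i]).

Definition cmod (z : C) : R := Normc.normc z.

Section OneSpace.
Variable V : lmodType C.
Variable ip : V -> V -> C.

Definition inner_product_axioms : Prop :=
  [/\ (forall (a : C) (x y z : V), ip (a *: x + y) z = a * ip x z + ip y z),
      (forall x y : V, ip y x = conjc (ip x y)),
      (forall x : V, 0 <= complex.Re (ip x x)) &
      (forall x : V, ip x x = 0 -> x = 0)].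

Definition hnorm (x : V) : R := Num.sqrt (complex.Re (ip x x)).

Definition complete_space : Prop :=
  forall u : nat -> V,
    (forall e : R, 0 < e -> exists N, forall m n, (N <= m)%N -> (N <= n)%N ->
       hnorm (u m - u n) < e) ->
    exists l : V, forall e : R, 0 < e -> exists N, forall n, (N <= n)%N ->
       hnorm (u n - l) < e.

Definition separable_space : Prop :=
  exists d : nat -> V, forall (x : V) (e : R), 0 < e ->
    exists n, hnorm (x - d n) < e.

Definition separable_hilbert : Prop :=
  [/\ inner_product_axioms, complete_space & separable_space].

Definition orthonormal_seq (u : nat -> V) : Prop :=
  forall m n : nat, ip (u m) (u n) = (m == n)%:R.

Definition infinite_dimensional : Prop := exists u : nat -> V, orthonormal_seq u.

Definition ess_num_range (T : V -> V) : set C :=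
  [set l : C | exists u : nat -> V, orthonormal_seq u /\
     forall e : R, 0 < e -> exists N, forall n, (N <= n)%N ->
       cmod (ip (T (u n)) (u n) - l) < e].

End OneSpace.

Section Operators.
Variables (K W : lmodType C) (ipK : K -> K -> C) (ipW : W -> W -> C).

Definition is_linear (T : K -> W) : Prop :=
  forall (a : C) (x y : K), T (a *: x + y) = a *: T x + T y.

Definition bounded_op (T : K -> W) : Prop :=
  is_linear T /\ exists c : R, forall x, hnorm ipW (T x) <= c * hnorm ipK x.

Definition opnorm (T : K -> W) : R :=
  sup [set hnorm ipW (T x) | x in [set x : K | hnorm ipK x <= 1]].

Definition is_isometry (T : K -> W) : Prop :=
  forall x, hnorm ipW (T x) = hnorm ipK x.

Definition is_adjoint (T : K -> W) (Ts : W -> K) : Prop :=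
  forall (x : K) (y : W), ipK (Ts y) x = ipW y (T x).

Definition op_path (F : R -> K -> W) : Prop :=
  (forall t : R, 0 <= t <= 1 -> bounded_op (F t)) /\
  (forall t : R, 0 <= t <= 1 -> forall e : R, 0 < e -> exists2 d : R, 0 < d &
     forall s : R, 0 <= s <= 1 -> `|s - t| < d ->
       opnorm (fun x => F s x - F t x) < e).

End Operators.

Definition cinterior (S : set C) : set C :=
  [set l | exists2 e : R, 0 < e & forall m : C, cmod (m - l) < e -> S m].

Definition cboundary (S : set C) : set C :=
  [set l | forall e : R, 0 < e ->
     (exists2 m : C, S m & cmod (m - l) < e) /\
     (exists2 m : C, ~ S m & cmod (m - l) < e)].

Definition dist0 (S : set C) : R := inf [set cmod l | l in S].

End HilbertDefs.

(* Main.v *)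
(* A strict contraction X on Z is a compression of the shift: for
   Delta = (1 - X^* X)^(1/2) the map z |-> (Delta X^j z)_j is isometric and
   carries the (backward) shift to X.  Cutting it off after finitely many terms,
   with X^N z as last component, costs an error of size q^N when |X| <= q < 1.

   On the other side, W_e(A t) contains the disc of radius r with
   sup |D| < r < inf dist(0, bd W_e), so that orthonormal vectors can be selected
   inductively along which finitely many operators A(t_i) are, up to a small
   error in operator norm, diagonal with entries r w^(-c), w a primitive n-th root
   of unity; a discrete Fourier transform turns this into r times the cyclic shift
   on Z^n.  The families selected for different i are orthogonal and nearly
   orthogonal for all the A(t_l), hence a quadratic partition of unity glues them
   to a continuous path of isometries V(t) : Z^n -> H under which every A(t)
   compresses to nearly r times the shift.

   Then S(t) = sum_j V_j(t) T_j(X t), with T_j(X) the components of the model,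
   where X t solves S(t)^* A(t) S(t) = D(t).  The left-hand side is r X up to a
   perturbation which is Lipschitz in X with a small constant, so the contraction
   principle yields X t, and its stability yields continuity in t. *)

Require Import Defs.
From HB Require Import structures.
From mathcomp Require Import all_boot all_order all_algebra.
From mathcomp Require Import boolp classical_sets reals.
From mathcomp Require Import cyclic separable cyclotomic.
From mathcomp Require Import topology normedtype realfun complex ring lra.
Set Implicit Arguments. Unset Strict Implicit. Unset Printing Implicit Defensive.
Import Order.TTheory GRing.Theory Num.Theory numFieldNormedType.Exports.
Local Open Scope ring_scope.
Local Open Scope classical_set_scope.
Local Open Scope complex_scope.
(* In ring_scope the notation would otherwise be the conjugation of a
   numClosedFieldType, which is not syntactically conjc. *)
Local Notation "z ^*" := (conjc z) : ring_scope.

(** * Inner products and operators *)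

(** Isometries solving the equation at different times can in general not be averaged into a
    solution, because the condition is quadratic in S. The gluing is therefore done for a target
    independent of t, r times the cyclic shift, and only approximately; all dependence on D and all
    errors are absorbed into the choice of X. The shift is taken cyclic because it is then normal
    with eigenvalues on the circle of radius r, where diagonal entries can be prescribed.

    The constants must be fixed in a definite order. The gap between sup |D| and r leaves room for
    |X| <= q < 1; the length of the model is chosen from q, the tolerance for the compression from
    that length, and only then the cover of [0,1] and the vectors in H. Hence the model has to be
    uniform over the ball of radius q and Lipschitz in X. Its defect operator comes from a fixed
    point equation, which supplies both existence and the Lipschitz bound.

    Operators are plain functions, and most relations between them are stated through sesquilinear
    forms, so that adjoints enter only at the end. *)

Section ComplexModulus.
Variable R : realType.
Implicit Types a b z : R[i].

Lemma cmodE z : (cmod z)%:C = `|z|.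
Proof. by case: z. Qed.

Lemma cmod_ge0 z : 0 <= cmod z.
Proof. by rewrite -lecR cmodE normr_ge0. Qed.

Lemma cmod0 : cmod (0 : R[i]) = 0.
Proof. exact: Normc.normc0. Qed.

Lemma cmodM a b : cmod (a * b) = cmod a * cmod b.
Proof. exact: Normc.normcM. Qed.

Lemma cmodD a b : cmod (a + b) <= cmod a + cmod b.
Proof. exact: le_normcD. Qed.

Lemma cmodN a : cmod (- a) = cmod a.
Proof. exact: normcN. Qed.

Lemma cmodB a b : cmod (a - b) <= cmod a + cmod b.
Proof. by rewrite -(cmodN b); exact: cmodD. Qed.

Lemma cmodJ a : cmod a^* = cmod a.
Proof. by case: a => x y; rewrite /cmod /Normc.normc /= sqrrN. Qed.

Lemma cmodR (x : R) : cmod x%:C = `|x|.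
Proof. by rewrite /cmod /Normc.normc /= expr0n addr0 sqrtr_sqr. Qed.

Lemma cmod1 : cmod (1 : R[i]) = 1.
Proof. by rewrite -[1]/(1%:C) cmodR normr1. Qed.

Lemma cmodX a n : cmod (a ^+ n) = cmod a ^+ n.
Proof. by elim: n => [|n IH]; rewrite ?expr0 ?cmod1 // !exprS cmodM IH. Qed.

Lemma cmod_eq0 z : cmod z = 0 -> z = 0.
Proof. exact: Normc.eq0_normc. Qed.

Lemma cmodV a : cmod a^-1 = (cmod a)^-1.
Proof. exact: Normc.normcV. Qed.

Lemma mulcJ z : z * z^* = (cmod z ^+ 2)%:C.
Proof. by rewrite -sqr_normc -cmodE rmorphXn. Qed.

Lemma Re_le_cmod z : complex.Re z <= cmod z.
Proof.
case: z => x y; rewrite /cmod /Normc.normc /=.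
apply: le_trans (ler_norm _) _; rewrite -sqrtr_sqr.
by apply: ler_wsqrtr; rewrite lerDl sqr_ge0.
Qed.

Lemma cmod_sum (I : Type) (r : seq I) (P : pred I) (F : I -> R[i]) :
  cmod (\sum_(i <- r | P i) F i) <= \sum_(i <- r | P i) cmod (F i).
Proof.
elim/big_rec2: _ => [|i x y _ h]; first by rewrite cmod0.
by apply: le_trans (cmodD _ _) _; rewrite lerD2l.
Qed.

End ComplexModulus.

Section InnerProduct.
Variables (R : realType) (V : lmodType R[i]) (ip : V -> V -> R[i]).
Hypothesis hip : inner_product_axioms ip.
Implicit Types (x y z : V) (a : R[i]).
Local Notation nm := (hnorm ip).

Lemma ipC x y : ip y x = (ip x y)^*.
Proof. by case: hip. Qed.

Lemma ip_lin a x y z : ip (a *: x + y) z = a * ip x z + ip y z.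
Proof. by case: hip. Qed.

Lemma ipDl x y z : ip (x + y) z = ip x z + ip y z.
Proof. by rewrite -{1}[x]scale1r ip_lin mul1r. Qed.

Lemma ip0l z : ip 0 z = 0.
Proof. by apply: (addIr (ip 0 z)); rewrite -ipDl !add0r. Qed.

Lemma ipZl a x z : ip (a *: x) z = a * ip x z.
Proof. by rewrite -[a *: x]addr0 ip_lin ip0l addr0. Qed.

Lemma ipNl x z : ip (- x) z = - ip x z.
Proof. by rewrite -scaleN1r ipZl mulN1r. Qed.

Lemma ipBl x y z : ip (x - y) z = ip x z - ip y z.
Proof. by rewrite ipDl ipNl. Qed.

Lemma ipDr x y z : ip z (x + y) = ip z x + ip z y.
Proof. by rewrite ipC ipDl rmorphD /= -!ipC. Qed.

Lemma ipZr a x z : ip z (a *: x) = a^* * ip z x.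
Proof. by rewrite ipC ipZl rmorphM /= -ipC. Qed.

Lemma ip0r z : ip z 0 = 0.
Proof. by rewrite ipC ip0l conjc0. Qed.

Lemma ipNr x z : ip z (- x) = - ip z x.
Proof. by rewrite ipC ipNl rmorphN /= -ipC. Qed.

Lemma ipBr x y z : ip z (x - y) = ip z x - ip z y.
Proof. by rewrite ipDr ipNr. Qed.

Lemma ip_suml (I : Type) (r : seq I) (P : pred I) (F : I -> V) z :
  ip (\sum_(i <- r | P i) F i) z = \sum_(i <- r | P i) ip (F i) z.
Proof. by elim/big_rec2: _ => [|i x y _ <-]; rewrite ?ip0l ?ipDl. Qed.

Lemma ip_sumr (I : Type) (r : seq I) (P : pred I) (F : I -> V) z :
  ip z (\sum_(i <- r | P i) F i) = \sum_(i <- r | P i) ip z (F i).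
Proof. by elim/big_rec2: _ => [|i x y _ <-]; rewrite ?ip0r ?ipDr. Qed.

Lemma hnorm_ge0 x : 0 <= nm x.
Proof. exact: sqrtr_ge0. Qed.

Lemma ipxx x : ip x x = (nm x ^+ 2)%:C.
Proof.
have [_ _ h _] := hip; rewrite /hnorm sqr_sqrtr //.
by have := ipC x x; case: (ip x x) => a b /= [] /eqP; rewrite -addr_eq0
  -mulr2n mulrn_eq0 /= => /eqP ->.
Qed.

Lemma hnorm_sqr x : nm x ^+ 2 = complex.Re (ip x x).
Proof. by rewrite ipxx. Qed.

Lemma hnorm_eq0 x : nm x = 0 -> x = 0.
Proof. by move=> h; have [_ _ _] := hip; apply; rewrite ipxx h expr0n. Qed.

Lemma hnorm0 : nm 0 = 0.
Proof. by rewrite /hnorm ip0l sqrtr0. Qed.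

Lemma hnormZ a x : nm (a *: x) = cmod a * nm x.
Proof.
apply/eqP; rewrite -(@eqrXn2 _ 2) ?mulr_ge0 ?hnorm_ge0 ?cmod_ge0 //.
by rewrite hnorm_sqr ipZl ipZr mulrA mulcJ ipxx -rmorphM /= exprMn.
Qed.

Lemma hnormN x : nm (- x) = nm x.
Proof. by rewrite -scaleN1r hnormZ cmodN cmod1 mul1r. Qed.

Lemma hnormBC x y : nm (x - y) = nm (y - x).
Proof. by rewrite -hnormN opprB. Qed.

Lemma hnormD_sqr x y :
  nm (x + y) ^+ 2 = nm x ^+ 2 + nm y ^+ 2 + 2 * complex.Re (ip x y).
Proof.
rewrite hnorm_sqr ipDl !ipDr [ip y x]ipC !ipxx.
case: (ip x y) => a b /=; ring.
Qed.

Lemma pythagoras x y : ip x y = 0 -> nm (x + y) ^+ 2 = nm x ^+ 2 + nm y ^+ 2.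
Proof. by move=> h; rewrite hnormD_sqr h /= mulr0 addr0. Qed.

Lemma cauchy_schwarz x y : cmod (ip x y) <= nm x * nm y.
Proof.
have [/hnorm_eq0 ->|ny] := eqVneq (nm y) 0.
  by rewrite ip0r cmod0 mulr_ge0 ?hnorm_ge0.
have ny0 : 0 < nm y by rewrite lt_neqAle eq_sym ny hnorm_ge0.
have nyC : (nm y ^+ 2)%:C != 0 :> R[i].
  by rewrite -[0]/(0%:C) (inj_eq (fmorph_inj _)) expf_neq0.
pose c := ip x y / (nm y ^+ 2)%:C.
have xE : x = (x - c *: y) + c *: y by rewrite subrK.
have h0 : ip (x - c *: y) (c *: y) = 0.
  by rewrite ipZr ipBl ipZl ipxx /c divfK // subrr mulr0.
have /eqP := pythagoras h0; rewrite -xE hnormZ /c cmodM cmodV cmodR.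
rewrite ger0_norm ?sqr_ge0 // => /eqP h.
rewrite -(@ler_pXn2r _ 2) ?nnegrE ?mulr_ge0 ?hnorm_ge0 ?cmod_ge0 //.
rewrite exprMn h mulrDl.
have -> : (cmod (ip x y) / nm y ^+ 2 * nm y) ^+ 2 * nm y ^+ 2
  = cmod (ip x y) ^+ 2 by field.
by rewrite lerDr mulr_ge0 ?sqr_ge0.
Qed.

Lemma hnormD x y : nm (x + y) <= nm x + nm y.
Proof.
rewrite -(@ler_pXn2r _ 2) ?nnegrE ?addr_ge0 ?hnorm_ge0 // hnormD_sqr.
have := le_trans (Re_le_cmod _) (cauchy_schwarz x y).
nra.
Qed.

Lemma hnormB x y : nm (x - y) <= nm x + nm y.
Proof. by rewrite -(hnormN y) hnormD. Qed.

Lemma hnorm_dist x y : nm x <= nm y + nm (x - y).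
Proof. by rewrite -{1}(subrK y x) addrC hnormD. Qed.

Lemma hnorm_dist_trans x y z : nm (x - z) <= nm (x - y) + nm (y - z).
Proof. by rewrite -{1}(subrK y x) -addrA hnormD. Qed.

Lemma hnorm_sum (I : Type) (r : seq I) (P : pred I) (F : I -> V) :
  nm (\sum_(i <- r | P i) F i) <= \sum_(i <- r | P i) nm (F i).
Proof.
elim/big_rec2: _ => [|i x y _ h]; first by rewrite hnorm0.
by apply: le_trans (hnormD _ _) _; rewrite lerD2l.
Qed.

(** Test with y = x. This is how a bound on a sesquilinear form becomes a bound on an operator. *)
Lemma hnorm_dual x (c : R) : 0 <= c ->
  (forall y, cmod (ip x y) <= c * nm y) -> nm x <= c.
Proof.
move=> c0 /(_ x); rewrite ipxx cmodR ger0_norm ?sqr_ge0 // expr2.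
have [->|nx] := eqVneq (nm x) 0; first by [].
by rewrite ler_pM2r // lt_neqAle eq_sym nx hnorm_ge0.
Qed.

Lemma ip_inj x y : (forall z, ip x z = ip y z) -> x = y.
Proof.
move=> h; apply/subr0_eq/hnorm_eq0/eqP; rewrite eq_le hnorm_ge0 andbT.
by apply: hnorm_dual => // z; rewrite ipBl h subrr cmod0 mul0r.
Qed.

End InnerProduct.

Section LinearMaps.
Variables (R : realType) (K W : lmodType R[i]).
Implicit Types (T : K -> W).

Lemma linD T x y : is_linear T -> T (x + y) = T x + T y.
Proof. by move=> h; rewrite -{1}[x]scale1r h scale1r. Qed.

Lemma lin0 T : is_linear T -> T 0 = 0.
Proof. by move=> h; apply: (addIr (T 0)); rewrite -linD // !add0r. Qed.

Lemma linZ T a x : is_linear T -> T (a *: x) = a *: T x.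
Proof. by move=> h; rewrite -[a *: x]addr0 h lin0 // addr0. Qed.

Lemma linN T x : is_linear T -> T (- x) = - T x.
Proof. by move=> h; rewrite -scaleN1r linZ // scaleN1r. Qed.

Lemma linB T x y : is_linear T -> T (x - y) = T x - T y.
Proof. by move=> h; rewrite linD // linN. Qed.

Lemma lin_sum (I : Type) (r : seq I) (P : pred I) (F : I -> K) T :
  is_linear T ->
  T (\sum_(i <- r | P i) F i) = \sum_(i <- r | P i) T (F i).
Proof. by move=> h; elim/big_rec2: _ => [|i x y _ <-]; rewrite ?lin0 ?linD. Qed.

Lemma linear_sub T T' : is_linear T -> is_linear T' ->
  is_linear (fun x => T x - T' x).
Proof. by move=> h h' a x y; rewrite h h' scalerBr opprD addrACA. Qed.

End LinearMaps.

(** Estimates are carried by this predicate rather than by [opnorm]: it composes without any check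
    that the supremum defining [opnorm] is finite. The two are linked by [bounded_opP] and
    [opnorm_le]. *)
Definition bnd (R : realType) (K W : lmodType R[i]) (ipK : K -> K -> R[i])
  (ipW : W -> W -> R[i]) (c : R) (T : K -> W) : Prop :=
  forall x, hnorm ipW (T x) <= c * hnorm ipK x.

Section OperatorNorm.
Variables (R : realType) (K W : lmodType R[i]).
Variables (ipK : K -> K -> R[i]) (ipW : W -> W -> R[i]).
Hypotheses (hK : inner_product_axioms ipK) (hW : inner_product_axioms ipW).
Implicit Types (T : K -> W).
Local Notation bnd := (bnd ipK ipW).

Lemma bnd_le c d T : c <= d -> bnd c T -> bnd d T.
Proof. by move=> h hT x; apply: le_trans (hT x) _; rewrite ler_wpM2r ?hnorm_ge0. Qed.

Lemma opnorm_le c T : 0 <= c -> bnd c T -> opnorm ipK ipW T <= c.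
Proof.
move=> c0 hT; apply: ge_sup.
  by exists (hnorm ipW (T 0)), 0 => //=; rewrite hnorm0.
move=> _ [x /= x1 <-]; apply: le_trans (hT x) _.
by rewrite -[leRHS]mulr1 ler_wpM2l.
Qed.

Lemma bounded_opP T : bounded_op ipK ipW T -> bnd (opnorm ipK ipW T) T.
Proof.
move=> [lT [c hT]] x.
have hs : has_sup [set hnorm ipW (T x) | x in [set x : K | hnorm ipK x <= 1]].
  split; first by exists (hnorm ipW (T 0)), 0 => //=; rewrite hnorm0.
  exists `|c| => _ [y /= y1 <-]; apply: le_trans (hT y) _.
  have := hnorm_ge0 ipK y; have := ler_norm c; have := normr_ge0 c; nra.
have [x0|nx] := eqVneq (hnorm ipK x) 0.
  by rewrite (hnorm_eq0 hK x0) lin0 // !hnorm0 // mulr0.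
have nx0 : 0 < hnorm ipK x by rewrite lt_neqAle eq_sym nx hnorm_ge0.
have cx : cmod ((hnorm ipK x)^-1%:C) = (hnorm ipK x)^-1.
  by rewrite cmodR ger0_norm // invr_ge0 ltW.
have : hnorm ipW (T ((hnorm ipK x)^-1%:C *: x)) <= opnorm ipK ipW T.
  apply: ub_le_sup => //; first by case: hs.
  by exists ((hnorm ipK x)^-1%:C *: x) => //=; rewrite hnormZ // cx mulVf.
by rewrite linZ // hnormZ // cx mulrC ler_pdivrMr.
Qed.

Lemma opnorm_ge0 T : bounded_op ipK ipW T -> 0 <= opnorm ipK ipW T.
Proof.
move=> [lT [c hT]]; apply: ub_le_sup; last first.
  by exists 0 => /=; rewrite ?hnorm0 // lin0 // hnorm0.
exists `|c| => _ [y /= y1 <-]; apply: le_trans (hT y) _.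
have := hnorm_ge0 ipK y; have := ler_norm c; have := normr_ge0 c; nra.
Qed.

Lemma bnd_bounded_op c T : is_linear T -> bnd c T -> bounded_op ipK ipW T.
Proof. by move=> lT hT; split => //; exists c. Qed.

Lemma bounded_op_sub T T' : bounded_op ipK ipW T -> bounded_op ipK ipW T' ->
  bounded_op ipK ipW (fun x => T x - T' x).
Proof.
move=> [lT [c hT]] [lT' [c' hT']]; split; first exact: linear_sub.
exists (c + c') => x; apply: le_trans (hnormB hW _ _) _.
by rewrite mulrDl lerD.
Qed.

End OperatorNorm.

(** * Limits and orthogonal families *)

(** Choice in which the n-th value may depend on all earlier ones. The second hypothesis says that
    [G n] reads its sequence only below n, so any sequence with the right initial segment may be
    supplied. *)
Lemma recursive_choice (T : Type) (x0 : T) (G : nat -> (nat -> T) -> T -> Prop) :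
  (forall n u, exists v, G n u v) ->
  (forall n u u' v, (forall i, (i < n)%N -> u i = u' i) -> G n u v -> G n u' v) ->
  exists u, forall n, G n u (u n).
Proof.
move=> ex ext; have [f hf] := choice (fun p : nat * (nat -> T) => ex p.1 p.2).
(* [F n] stores the values chosen before n and equals the default [x0] from n on. *)
pose F := fix F n := if n is m.+1 then
  fun i => if i == m then f (m, F m) else F m i else fun=> x0.
have FE n i : (i < n)%N -> F n i = f (i, F i).
  elim: n => // n IH; rewrite ltnS leq_eqVlt /= => /predU1P[->|h].
    by rewrite eqxx.
  by rewrite ltn_eqF // IH.
exists (fun n => f (n, F n)) => n.
by apply: ext (hf (n, F n)) => i /FE.
Qed.

Lemma nondecreasing_bounded_cauchy (R : realType) (s : nat -> R) (M : R) :
  {homo s : m n / (m <= n)%N >-> m <= n} -> (forall n, s n <= M) ->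
  forall e, 0 < e -> exists N, forall m n, (N <= m)%N -> (N <= n)%N ->
    `|s m - s n| < e.
Proof.
move=> mono ub e e0.
have hs : has_sup (range s).
  by split; [exists (s 0%N), 0%N|exists M => _ [n _ <-]].
have [_ [N _ <-] hN] := sup_adherent e0 hs.
have le n : s n <= sup (range s).
  by apply: ub_le_sup; [case: hs|exists n].
exists N => m n hm hn.
by have := le m; have := le n; have := mono _ _ hm; have := mono _ _ hn; move: hN;
  rewrite ltr_norml; set S := sup _; lra.
Qed.

Definition ccvg (R : realType) (a : nat -> R[i]) (l : R[i]) : Prop :=
  forall e : R, 0 < e -> exists N, forall n, (N <= n)%N -> cmod (a n - l) < e.

Section ComplexLimits.
Variable R : realType.
Implicit Types (a b : nat -> R[i]).

Lemma ccvg_uniq a l l' : ccvg a l -> ccvg a l' -> l = l'.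
Proof.
move=> h h'; apply/subr0_eq/cmod_eq0/eqP; rewrite eq_le cmod_ge0 andbT.
apply/ler_addgt0Pr => e e0; rewrite add0r.
have e2 : 0 < e / 2 by lra.
have [N hN] := h _ e2; have [N' hN'] := h' _ e2.
have := hN _ (leq_maxl N N'); have := hN' _ (leq_maxr N N').
set x := a _; have -> : l - l' = (x - l') - (x - l) by ring.
have := cmodB (x - l') (x - l); lra.
Qed.

Lemma ccvg_le a l (c : R) : ccvg a l -> (forall n, cmod (a n) <= c) ->
  cmod l <= c.
Proof.
move=> h ha; apply/ler_addgt0Pr => e e0.
have [N /(_ _ (leqnn N))] := h _ e0; have := ha N.
have := cmodB (a N) (a N - l); rewrite (_ : a N - (a N - l) = l); first lra.
ring.
Qed.

Lemma ccvg_sub a b l m : ccvg a l -> ccvg b m ->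
  ccvg (fun n => a n - b n) (l - m).
Proof.
move=> h h' e e0; have e2 : 0 < e / 2 by lra.
have [N hN] := h _ e2; have [N' hN'] := h' _ e2.
exists (maxn N N') => n; rewrite geq_max => /andP[/hN h1 /hN' h2].
have -> : a n - b n - (l - m) = (a n - l) - (b n - m) by ring.
have := cmodB (a n - l) (b n - m); lra.
Qed.

Lemma ccvg_mull c a l : ccvg a l -> ccvg (fun n => c * a n) (c * l).
Proof.
move=> h e e0; have c1 : 0 < cmod c + 1 by have := cmod_ge0 c; lra.
have [|N hN] := h (e / (cmod c + 1)); first exact: divr_gt0.
exists N => n /hN; rewrite ltr_pdivlMr // -mulrBr cmodM.
have := cmod_ge0 (a n - l); have := cmod_ge0 c; nra.
Qed.

End ComplexLimits.

Definition cvgto (R : realType) (V : lmodType R[i]) (ip : V -> V -> R[i])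
    (u : nat -> V) (l : V) : Prop :=
  forall e : R, 0 < e -> exists N, forall n, (N <= n)%N ->
    hnorm ip (u n - l) < e.

Section VectorLimits.
Variables (R : realType) (V : lmodType R[i]) (ip : V -> V -> R[i]).
Hypothesis hip : inner_product_axioms ip.
Implicit Types (u v : nat -> V) (x y z : V).
Local Notation nm := (hnorm ip).
Local Notation cvgto := (cvgto ip).

Lemma cvgto_ip u v l m : cvgto u l -> cvgto v m ->
  ccvg (fun n => ip (u n) (v n)) (ip l m).
Proof.
move=> hu hv e e0.
have k0 : 0 < nm l + nm m + 1.
  by have := hnorm_ge0 ip l; have := hnorm_ge0 ip m; lra.
(* The cap 1 keeps |v n| below |m| + 1, so that the two error terms together are at most d (|l| +
   |m| + 1) <= e / 2. *)
pose d := Num.min 1 (e / (2 * (nm l + nm m + 1))).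
have d0 : 0 < d by rewrite lt_min ltr01 divr_gt0 // mulr_gt0.
have d1 : d <= 1 by rewrite ge_min lexx.
have d2 : d * (2 * (nm l + nm m + 1)) <= e.
  by rewrite -ler_pdivlMr ?mulr_gt0 // ge_min lexx orbT.
have [N hN] := hu _ d0; have [N' hN'] := hv _ d0.
exists (maxn N N') => n; rewrite geq_max => /andP[/hN h1 /hN' h2].
have -> : ip (u n) (v n) - ip l m = ip (u n - l) (v n) + ip l (v n - m).
  by rewrite ipBl // ipBr //; ring.
have := cmodD (ip (u n - l) (v n)) (ip l (v n - m)).
have := cauchy_schwarz hip (u n - l) (v n).
have := cauchy_schwarz hip l (v n - m).
have := hnorm_dist hip (v n) m.
have := hnorm_ge0 ip (u n - l); have := hnorm_ge0 ip (v n - m).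
have := hnorm_ge0 ip l; have := hnorm_ge0 ip m; have := hnorm_ge0 ip (v n).
move=> g1 g2 g3 g4 g5 g6 g7 g8 g9; apply: le_lt_trans g9 _.
have : nm (u n - l) * nm (v n) <= d * (nm m + d).
  by apply: ler_pM => //; lra.
have : nm l * nm (v n - m) <= nm l * d by rewrite ler_wpM2l // ltW.
nra.
Qed.

Lemma cvgto_uniq u l l' : cvgto u l -> cvgto u l' -> l = l'.
Proof.
move=> h h'; apply: (ip_inj hip) => z.
have hz : cvgto (fun=> z) z by move=> e e0; exists 0%N => n _; rewrite subrr hnorm0.
exact: ccvg_uniq (cvgto_ip h hz) (cvgto_ip h' hz).
Qed.

Lemma cvgto_cst z : cvgto (fun=> z) z.
Proof. by move=> e e0; exists 0%N => n _; rewrite subrr hnorm0. Qed.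

Lemma cvgto_lin a u v l m : cvgto u l -> cvgto v m ->
  cvgto (fun n => a *: u n + v n) (a *: l + m).
Proof.
move=> hu hv e e0; have e2 : 0 < e / 2 by lra.
have c1 : 0 < cmod a + 1 by have := cmod_ge0 a; lra.
have [|N hN] := hu (e / 2 / (cmod a + 1)); first exact: divr_gt0.
have [N' hN'] := hv _ e2.
exists (maxn N N') => n; rewrite geq_max => /andP[/hN h1 /hN' h2].
have -> : a *: u n + v n - (a *: l + m) = a *: (u n - l) + (v n - m).
  by rewrite opprD addrACA scalerBr.
have := hnormD hip (a *: (u n - l)) (v n - m).
rewrite hnormZ //; move: h1; rewrite ltr_pdivlMr //.
have := hnorm_ge0 ip (u n - l); have := cmod_ge0 a; nra.
Qed.

Lemma cvgto_le u l x (c : R) : cvgto u l -> (forall n, nm (u n - x) <= c) ->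
  nm (l - x) <= c.
Proof.
move=> h hc; apply/ler_addgt0Pr => e e0.
have [N /(_ _ (leqnn N))] := h _ e0; rewrite hnormBC //.
have := hnorm_dist_trans hip l (u N) x; have := hc N; lra.
Qed.

End VectorLimits.

Lemma cvgto_bnd (R : realType) (K W : lmodType R[i]) (ipK : K -> K -> R[i])
    (ipW : W -> W -> R[i]) (hK : inner_product_axioms ipK)
    (hW : inner_product_axioms ipW) T (c : R) u l :
  is_linear T -> bnd ipK ipW c T -> cvgto ipK u l ->
  cvgto ipW (fun n => T (u n)) (T l).
Proof.
move=> lT bT h e e0; have c1 : 0 < `|c| + 1 by have := normr_ge0 c; lra.
have [|N hN] := h (e / (`|c| + 1)); first exact: divr_gt0.
exists N => n /hN; rewrite ltr_pdivlMr // -linB //.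
have := bT (u n - l); have := hnorm_ge0 ipK (u n - l).
have := ler_norm c; nra.
Qed.

(** * Bessel's inequality, orthonormal bases and the Riesz representation *)

Section OrthogonalFamilies.
Variables (R : realType) (V : lmodType R[i]) (ip : V -> V -> R[i]).
Hypothesis hip : inner_product_axioms ip.
Implicit Types (u v : nat -> V) (x y z : V).
Local Notation nm := (hnorm ip).
Local Notation cvgto := (cvgto ip).

(* Zero vectors are allowed, so that a dense sequence can be orthonormalized
   without extracting a linearly independent subsequence. *)
Definition orthonormal_or_zero u (n : nat) : Prop :=
  (forall i j, (i < n)%N -> (j < n)%N -> i != j -> ip (u i) (u j) = 0) /\
  (forall i, (i < n)%N -> u i = 0 \/ ip (u i) (u i) = 1).

Definition ortho_proj u n z := \sum_(k < n) ip z (u k) *: u k.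

Lemma ip_proj u n z j : orthonormal_or_zero u n -> (j < n)%N ->
  ip (ortho_proj u n z) (u j) = ip z (u j).
Proof.
move=> [ho hu] jn; rewrite ip_suml // (bigD1 (Ordinal jn)) //= big1 => [|i /negPf ij].
  by rewrite addr0 ipZl //; case: (hu _ jn) => ->; rewrite ?(ip0r hip) ?mulr0 ?mulr1.
by rewrite ipZl // ho ?mulr0 //; exact: negbT ij.
Qed.

Lemma proj_orth u n z j : orthonormal_or_zero u n -> (j < n)%N ->
  ip (z - ortho_proj u n z) (u j) = 0.
Proof. by move=> hu jn; rewrite ipBl // ip_proj // subrr. Qed.

Lemma proj_orth_proj u n z w : orthonormal_or_zero u n ->
  ip (z - ortho_proj u n z) (ortho_proj u n w) = 0.
Proof.
by move=> hu; rewrite ip_sumr // big1 // => j _; rewrite ipZr // proj_orth // mulr0.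
Qed.

Lemma ip_proj_proj u n z w : orthonormal_or_zero u n ->
  ip (ortho_proj u n z) (ortho_proj u n w) = \sum_(k < n) ip z (u k) * (ip w (u k))^*.
Proof.
move=> hu; rewrite {2}/ortho_proj ip_sumr //; apply: eq_bigr => k _.
by rewrite ipZr // ip_proj // mulrC.
Qed.

Lemma hnorm_proj u n z : orthonormal_or_zero u n ->
  nm (ortho_proj u n z) ^+ 2 = \sum_(k < n) cmod (ip z (u k)) ^+ 2.
Proof.
move=> hu; rewrite hnorm_sqr // ip_proj_proj // raddf_sum.
by apply: eq_bigr => k _; rewrite mulcJ.
Qed.

Lemma hnorm_sub_proj u n z : orthonormal_or_zero u n ->
  nm z ^+ 2 = nm (z - ortho_proj u n z) ^+ 2 + nm (ortho_proj u n z) ^+ 2.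
Proof. by move=> hu; rewrite -pythagoras ?subrK // proj_orth_proj. Qed.

Lemma hnorm_sub_proj_le u n z : orthonormal_or_zero u n ->
  nm (z - ortho_proj u n z) <= nm z.
Proof.
move=> hu; rewrite -(@ler_pXn2r _ 2) ?nnegrE ?hnorm_ge0 //.
by rewrite (hnorm_sub_proj z hu) lerDl sqr_ge0.
Qed.

Lemma projB u n z w : ortho_proj u n (z - w) = ortho_proj u n z - ortho_proj u n w.
Proof.
by rewrite -sumrB; apply: eq_bigr => k _; rewrite ipBl // scalerBl.
Qed.

Lemma orthonormal_seq_or_zero u n : orthonormal_seq ip u -> orthonormal_or_zero u n.
Proof.
move=> hu; split=> [i j _ _ ij|i _]; first by rewrite hu (negPf ij).
by right; rewrite hu eqxx.
Qed.

(** Bessel's inequality for a functional not yet known to be an inner product. At the vector x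
    below, both g x and |x|^2 equal the sum s, so boundedness of g reads s^2 <= c^2 s. The Riesz
    representation rests on it. *)
Lemma functional_square_summable u n (g : V -> R[i]) (c : R) :
  orthonormal_or_zero u n -> 0 <= c ->
  (forall a x y, g (a *: x + y) = a * g x + g y) ->
  (forall x, cmod (g x) <= c * nm x) ->
  \sum_(k < n) cmod (g (u k)) ^+ 2 <= c ^+ 2.
Proof.
move=> hu c0 lg bg; pose x := \sum_(k < n) (g (u k))^* *: u k.
have g0 : g 0 = 0 by have := lg (-1) 0 0; rewrite scaler0 addr0 mulN1r addNr.
have gsum m (F : nat -> R[i]) :
    g (\sum_(k < m) F k *: u k) = \sum_(k < m) F k * g (u k).
  elim: m => [|m IH]; first by rewrite !big_ord0.
  by rewrite !big_ord_recr /= addrC lg IH addrC.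
set s := \sum_(k < n) _.
have s0 : 0 <= s by apply: sumr_ge0 => k _; exact: sqr_ge0.
have gx : g x = s%:C.
  rewrite /x (gsum n (fun k => (g (u k))^*)) /s rmorph_sum; apply: eq_bigr => k _ /=.
  by rewrite mulrC mulcJ.
have nx : nm x ^+ 2 = s.
  rewrite hnorm_sqr // -[RHS]/(complex.Re s%:C) -gx /x (gsum n (fun k => (g (u k))^*)) ip_suml //.
  congr complex.Re; apply: eq_bigr => k _; rewrite ipZl //; congr (_ * _).
  rewrite ip_sumr // (bigD1 k) //= big1 ?addr0.
    rewrite ipZr // conjcK; have [_ /(_ _ (ltn_ord k))[->|->]] := hu.
      by rewrite ip0l // g0 mulr0.
    by rewrite mulr1.
  by move=> i ik; rewrite ipZr //; have [-> //] := hu; rewrite ?mulr0 // eq_sym.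
have := bg x; rewrite gx cmodR ger0_norm // => h.
have [->|sn0] := eqVneq s 0; first exact: sqr_ge0.
have sp : 0 < s by rewrite lt_neqAle eq_sym sn0.
have : s ^+ 2 <= c ^+ 2 * s.
  by rewrite -nx -exprMn ler_pXn2r ?nnegrE ?mulr_ge0 ?hnorm_ge0 ?sqr_ge0 // nx.
by rewrite expr2 ler_pM2r.
Qed.

Lemma bounded_series_cauchy (M : R) (a : nat -> R) : (forall k, 0 <= a k) ->
  (forall n, \sum_(k < n) a k <= M) ->
  forall e : R, 0 < e -> exists N, forall m n, (N <= m)%N -> (m <= n)%N ->
    \sum_(m <= k < n) a k < e.
Proof.
move=> a0 hM e e0.
have mono : {homo (fun n => \sum_(k < n) a k) : m n / (m <= n)%N >-> m <= n}.
  move=> m n mn; rewrite -!(big_mkord xpredT a) (big_cat_nat _ mn) //=.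
  by rewrite lerDl sumr_ge0.
have [N hN] := nondecreasing_bounded_cauchy mono hM e0.
exists N => m n Nm mn; have := hN n m (leq_trans Nm mn) Nm.
rewrite -!(big_mkord xpredT a) (big_cat_nat _ mn) //= addrAC subrr add0r.
by apply: le_lt_trans (ler_norm _).
Qed.

(** The squares |g (u n)|^2 are summable. Far out, an orthonormal sequence thus meets any finite
    list of linear constraints up to a small error, which is what the inductive selection of vectors
    exploits. *)
Lemma weakly_null u (g : V -> R[i]) (c : R) : orthonormal_seq ip u -> 0 <= c ->
  (forall a x y, g (a *: x + y) = a * g x + g y) ->
  (forall x, cmod (g x) <= c * nm x) -> ccvg (fun n => g (u n)) 0.
Proof.
move=> hu c0 lg bg e e0.
have [N hN] := bounded_series_cauchy (fun k => sqr_ge0 (cmod (g (u k)))) (fun n =>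
  functional_square_summable (orthonormal_seq_or_zero n hu) c0 lg bg)
  (exprn_gt0 2 e0).
exists N => n Nn; have := hN n n.+1 Nn (leqnSn n); rewrite big_nat1 subr0.
by rewrite ltr_pXn2r // nnegrE ?cmod_ge0 // ltW.
Qed.

Lemma orthogonal_series (g : nat -> V) (M : R) : complete_space ip ->
  (forall i j, i != j -> ip (g i) (g j) = 0) ->
  (forall n, \sum_(k < n) nm (g k) ^+ 2 <= M) ->
  exists l, cvgto (fun n => \sum_(k < n) g k) l.
Proof.
move=> hc ho hM; apply: hc => e e0.
have [N hN] := bounded_series_cauchy (fun k => sqr_ge0 (nm (g k))) hM (exprn_gt0 2 e0).
have pyth m n : nm (\sum_(m <= k < n) g k) ^+ 2 = \sum_(m <= k < n) nm (g k) ^+ 2.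
  have [nm_|mn] := leqP n m; first by rewrite !big_geq // hnorm0 // expr0n.
  elim: n mn => // n IH; rewrite ltnS leq_eqVlt => /predU1P[->|mn].
    by rewrite !big_nat1.
  rewrite !big_nat_recr //= ?(ltnW mn) // pythagoras // ?IH // ip_suml //.
  by rewrite big_nat big1 // => i /andP[_ hi]; rewrite ho // ltn_eqF.
have key m n : (N <= m)%N -> (m <= n)%N ->
    nm (\sum_(k < n) g k - \sum_(k < m) g k) < e.
  move=> Nm mn; rewrite -!(big_mkord xpredT g) (big_cat_nat _ mn) //=.
  rewrite addrAC subrr add0r -(@ltr_pXn2r _ 2) ?nnegrE ?hnorm_ge0 ?(ltW e0) //.
  by rewrite pyth hN.
exists N => m n Nm Nn; have [mn|/ltnW nm_] := leqP m n; last exact: key.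
by rewrite hnormBC // key.
Qed.

Lemma gram_schmidt (d : nat -> V) : exists u,
  (forall n, orthonormal_or_zero u n) /\
  forall n, ortho_proj u n.+1 (d n) = d n.
Proof.
(* The requirement is conditional on the earlier vectors, so that a choice exists for every sequence
   u, as [recursive_choice] demands. *)
pose G n u (v : V) := orthonormal_or_zero u n ->
  [/\ forall i, (i < n)%N -> ip v (u i) = 0, v = 0 \/ ip v v = 1 &
   ortho_proj u n (d n) + ip (d n) v *: v = d n].
have [n u|n u u' v uu' h|u hu] := recursive_choice (0 : V) (G := G).
(* Since the inverse of 0 is 0, this is the zero vector when [d n] depends linearly on its
   predecessors. *)
- pose r := d n - ortho_proj u n (d n); exists ((nm r)^-1%:C *: r) => hu.
  have ro i : (i < n)%N -> ip r (u i) = 0 by exact: proj_orth.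
  split.
  + by move=> i ni; rewrite ipZl // ro // mulr0.
  + have [r0|r0] := eqVneq (nm r) 0; first by left; rewrite r0 invr0 scale0r.
    right; rewrite ipZl // ipZr // ipxx // conjc_real -!rmorphM /=.
    by congr (_%:C); field.
  + have [r0|r0] := eqVneq (nm r) 0.
      rewrite r0 invr0 scale0r scaler0 addr0; apply/esym/subr0_eq.
      exact: (hnorm_eq0 hip).
    have -> : ip (d n) ((nm r)^-1%:C *: r) = (nm r)%:C.
      rewrite ipZr // conjc_real -{1}(subrK (ortho_proj u n (d n)) (d n)) ipDl //.
      rewrite ipxx // [ip (ortho_proj _ _ _) _]ipC // proj_orth_proj // conjc0 addr0.
      by rewrite -rmorphM /=; congr (_%:C); rewrite -/r; field.
    rewrite scalerA -rmorphM /= divff // scale1r addrC subrK //.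
- move=> hu'; have hu : orthonormal_or_zero u n.
    split=> [i j ni nj ij|i ni]; first by rewrite !uu' // hu'.1.
    by rewrite uu' //; exact: hu'.2.
  have [h1 h2 h3] := h hu; split => //.
    by move=> i ni; rewrite -uu' // h1.
  rewrite -[RHS]h3; congr (_ + _); apply: eq_bigr => i _.
  by rewrite uu'.
have on n : orthonormal_or_zero u n.
  elim: n => [|n IH]; first by split.
  have [h1 h2 _] := hu n IH; split=> [i j|i].
    rewrite !ltnS [(i <= n)%N]leq_eqVlt [(j <= n)%N]leq_eqVlt.
    move=> /predU1P[->|ni] /predU1P[->|nj]; first by rewrite eqxx.
    - by move=> _; exact: h1.
    - by move=> _; rewrite ipC // h1 // conjc0.
    - exact: IH.1.
  rewrite ltnS leq_eqVlt => /predU1P[-> //|]; exact: IH.2.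
exists u; split=> // n; rewrite /ortho_proj big_ord_recr /=.
by have [_ _] := hu n (on n).
Qed.

Definition hilbert_basis (e : nat -> V) : Prop :=
  (forall n, orthonormal_or_zero e n) /\
  forall z, cvgto (fun n => ortho_proj e n z) z.

(** Orthonormalize a dense sequence. If [d m] is close to z, all projections of index above m fix
    [d m], so z minus its projection is the image of z - d m under a map of norm at most 1. *)
Lemma hilbert_basis_exists : separable_space ip -> exists e, hilbert_basis e.
Proof.
move=> [d hd]; have [u [on hu]] := gram_schmidt d; exists u; split=> // z e e0.
have [m hm] := hd z e e0; exists m.+1 => n mn; rewrite hnormBC //.
have -> : z - ortho_proj u n z = (z - d m) - ortho_proj u n (z - d m).
  have pd : ortho_proj u n (d m) = d m.
    rewrite -{2}(hu m) /ortho_proj -!(big_mkord xpredT (fun k => ip (d m) (u k) *: u k)).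
    rewrite (big_cat_nat _ mn) //= [X in _ + X]big_nat [X in _ + X]big1 ?addr0 // => k /andP[mk kn].
    rewrite -(hu m) ip_suml // big1 ?scale0r // => i _.
    have [h _] := on k.+1; rewrite ipZl // h ?mulr0 //.
      by rewrite ltnS ltnW // (leq_trans (ltn_ord i)).
    by rewrite ltn_eqF // (leq_trans (ltn_ord i)).
  by rewrite projB pd opprB addrA subrK.
exact: le_lt_trans (hnorm_sub_proj_le _ (on n)) hm.
Qed.

(** The representing vector is the sum of conj (g (e k)) e k over a basis; it converges by
    [functional_square_summable] and represents g because g is continuous along the projections of
    x. *)
Lemma riesz (g : V -> R[i]) (c : R) : complete_space ip -> separable_space ip ->
  (forall a x y, g (a *: x + y) = a * g x + g y) ->
  (forall x, cmod (g x) <= c * nm x) -> exists y, forall x, g x = ip x y.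
Proof.
move=> hc hs lg bg0; have [e [on he]] := hilbert_basis_exists hs.
have bg x : cmod (g x) <= `|c| * nm x.
  by apply: le_trans (bg0 x) _; rewrite ler_wpM2r ?hnorm_ge0 ?ler_norm.
have [|n|y hy] := @orthogonal_series (fun k => (g (e k))^* *: e k) (`|c| ^+ 2) hc.
- move=> i j ij; rewrite ipZl // ipZr //; have [-> //] := on (maxn i j).+1.
  + by rewrite !mulr0.
  + by rewrite ltnS leq_maxl.
  + by rewrite ltnS leq_maxr.
- apply: le_trans (functional_square_summable (on n) (normr_ge0 c) lg bg).
  apply: ler_sum => k _; rewrite hnormZ // cmodJ exprMn.
  rewrite -[leRHS]mulr1 ler_wpM2l ?sqr_ge0 // hnorm_sqr //.
  by have [_ /(_ k (ltn_ord k))[->|->]] := on n; rewrite ?ip0l.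
exists y => x; apply: ccvg_uniq (cvgto_ip hip (cvgto_cst hip x) hy) => eps eps0.
have c1 : 0 < `|c| + 1 by have := normr_ge0 c; lra.
have [|N hN] := he x (eps / (`|c| + 1)); first exact: divr_gt0.
exists N => n /hN; rewrite ltr_pdivlMr //.
have -> : ip x (\sum_(k < n) (g (e k))^* *: e k) - g x = g (ortho_proj e n x - x).
  have gsum m (F : nat -> R[i]) :
      g (\sum_(k < m) F k *: e k) = \sum_(k < m) F k * g (e k).
    elim: m => [|m IH]; last by rewrite !big_ord_recr /= addrC lg IH addrC.
    have := lg (-1) 0 0; rewrite !big_ord0 scaler0 addr0 mulN1r addNr => ->.
    by [].
  rewrite [ortho_proj e n x - x]addrC -scaleN1r lg mulN1r addrC; congr (_ + _).
  rewrite (gsum n (fun k => ip x (e k))) ip_sumr //; apply: eq_bigr => k _.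
  by rewrite ipZr // conjcK mulrC.
have := bg (ortho_proj e n x - x); have := hnorm_ge0 ip (ortho_proj e n x - x).
nra.
Qed.

End OrthogonalFamilies.

(** * Adjoints, embeddings and selection of vectors *)

Definition for_large_n (P : nat -> Prop) : Prop :=
  exists N, forall n, (N <= n)%N -> P n.

Lemma for_large_n_and P Q : for_large_n P -> for_large_n Q ->
  for_large_n (fun n => P n /\ Q n).
Proof.
move=> [N hN] [M hM]; exists (maxn N M) => n; rewrite geq_max => /andP[h1 h2].
by split; [exact: hN|exact: hM].
Qed.

Lemma for_large_n_forall (I : finType) (P : I -> nat -> Prop) :
  (forall i, for_large_n (P i)) -> for_large_n (fun n => forall i, P i n).
Proof.
move=> h; have [N hN] := choice h; exists (\max_i N i) => n hn i.
by apply: hN; apply: leq_trans hn; exact: leq_bigmax.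
Qed.

Section Adjoints.
Variables (R : realType) (W Z : lmodType R[i]).
Variables (ipW : W -> W -> R[i]) (ipZ : Z -> Z -> R[i]).
Hypotheses (hW : inner_product_axioms ipW) (hZ : separable_hilbert ipZ).

(** Apply Riesz to the conjugate of B w for each w; linearity and the bound are read off the form.
    It yields adjoints, the operator X^* X, and the map whose fixed point is X. *)
Lemma sesquilinear_operator (B : W -> Z -> R[i]) (c : R) : 0 <= c ->
  (forall a w w' z, B (a *: w + w') z = a * B w z + B w' z) ->
  (forall a w z z', B w (a *: z + z') = a^* * B w z + B w z') ->
  (forall w z, cmod (B w z) <= c * hnorm ipW w * hnorm ipZ z) ->
  exists K : W -> Z, [/\ is_linear K, bnd ipW ipZ c K &
    forall w z, ipZ (K w) z = B w z].
Proof.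
move=> c0 l1 l2 hB; have [iZ cZ sZ] := hZ.
have ex w : exists y, forall z, (B w z)^* = ipZ z y.
  apply: (@riesz _ _ _ iZ _ (c * hnorm ipW w)) => //.
    by move=> a x y; rewrite l2 rmorphD rmorphM /= conjcK.
  by move=> x; rewrite cmodJ.
have [K hK] := choice ex.
have KE w z : ipZ (K w) z = B w z by rewrite ipC // -hK conjcK.
exists K; split=> // [a w w'|w].
  by apply: (ip_inj iZ) => z; rewrite ip_lin // !KE l1.
by apply: (hnorm_dual iZ) => [|z]; rewrite ?mulr_ge0 ?hnorm_ge0 ?KE.
Qed.

Lemma adjoint_exists (T : Z -> W) (c : R) : 0 <= c -> is_linear T ->
  bnd ipZ ipW c T ->
  exists Ts : W -> Z, [/\ is_linear Ts, bnd ipW ipZ c Ts &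
    forall w z, ipZ (Ts w) z = ipW w (T z)].
Proof.
move=> c0 lT bT; apply: sesquilinear_operator => // [a w w' z|a w z z'|w z].
- by rewrite ip_lin.
- by rewrite lT ipDr // ipZr.
- apply: le_trans (cauchy_schwarz hW _ _) _.
  by rewrite [c * _]mulrC -mulrA ler_wpM2l ?hnorm_ge0.
Qed.

End Adjoints.

Lemma sum_half_powers (R : realType) n : \sum_(k < n) 2^-1 ^+ k <= 2 :> R.
Proof.
suff -> : \sum_(k < n) 2^-1 ^+ k = 2 - 2 * 2^-1 ^+ n :> R.
  by rewrite gerBl mulr_ge0 // exprn_ge0 // invr_ge0.
elim: n => [|n IH]; first by rewrite big_ord0 expr0 mulr1 subrr.
by rewrite big_ord_recr /= IH exprS; field.
Qed.

(** * Isometric embeddings of Z along orthonormal families in H *)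

Section Embeddings.
Variables (R : realType) (Z H : lmodType R[i]).
Variables (ipZ : Z -> Z -> R[i]) (ipH : H -> H -> R[i]).
Hypotheses (hZ : inner_product_axioms ipZ) (hH : inner_product_axioms ipH).
Hypothesis (cH : complete_space ipH).
Variables (e : nat -> Z) (he : hilbert_basis ipZ e).
Variables (I : finType) (u : I -> nat -> H).
Hypothesis ou : forall c c' k k',
  ipH (u c k) (u c' k') = ((c == c') && (k == k'))%:R.

Lemma basis_coef_le z k : cmod (ipZ z (e k)) <= hnorm ipZ z.
Proof.
apply: le_trans (cauchy_schwarz hZ _ _) _.
rewrite -[leRHS]mulr1 ler_wpM2l ?hnorm_ge0 // -(@ler_pXn2r _ 2) ?nnegrE ?hnorm_ge0 //.
rewrite expr1n hnorm_sqr //; have [_ /(_ k (ltnSn k))[->|->]] := he.1 k.+1 => //.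
by rewrite (ip0l hZ).
Qed.

Lemma embeddings_exist : exists U : I -> Z -> H, forall c z,
  cvgto ipH (fun n => \sum_(k < n) ipZ z (e k) *: u c k) (U c z).
Proof.
suff h c z : exists l, cvgto ipH (fun n => \sum_(k < n) ipZ z (e k) *: u c k) l.
  have [U hU] := choice (fun cz : I * Z => h cz.1 cz.2).
  by exists (fun c z => U (c, z)) => c z; exact: hU (c, z).
apply: (orthogonal_series hH (g := fun k => ipZ z (e k) *: u c k)
   (M := hnorm ipZ z ^+ 2) cH) => [i j ij|n].
  by rewrite ipZl // ipZr // ou (negPf ij) andbF !mulr0.
rewrite (hnorm_sub_proj hZ z (he.1 n)) (hnorm_proj hZ _ (he.1 n)).
rewrite -[leLHS]add0r lerD ?sqr_ge0 // ler_sum // => k _.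
rewrite hnormZ // exprMn [X in _ * X]hnorm_sqr // ou !eqxx /=.
by rewrite mulr1.
Qed.

Variables (U : I -> Z -> H).
Hypothesis hU : forall c z,
  cvgto ipH (fun n => \sum_(k < n) ipZ z (e k) *: u c k) (U c z).

Lemma embedding_linear c : is_linear (U c).
Proof.
move=> a x y; apply: (cvgto_uniq hH (hU c _)).
have h := cvgto_lin hH a (hU c x) (hU c y).
move=> eps eps0; have [N hN] := h eps eps0; exists N => n /hN.
congr (hnorm _ (_ - _) < _); rewrite scaler_sumr -big_split.
by apply: eq_bigr => k _; rewrite ip_lin // scalerDl scalerA.
Qed.

(** Expanding in the basis reduces the form to a double series of matrix entries. Their errors decay
    like 2^-k 2^-k', so they sum to at most 4 eta: entrywise control becomes control in operator
    norm. *)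
Lemma embedding_form (A : H -> H) (alpha eta : R) (b : I -> I -> R[i]) c c' :
  is_linear A -> bnd ipH ipH alpha A -> 0 <= eta ->
  (forall k k', cmod (ipH (A (u c k)) (u c' k') - b c c' * (k == k')%:R)
     <= eta * 2^-1 ^+ k * 2^-1 ^+ k') ->
  forall z z', cmod (ipH (A (U c z)) (U c' z') - b c c' * ipZ z z')
     <= 4 * eta * hnorm ipZ z * hnorm ipZ z'.
Proof.
move=> lA bA eta0 hm z z'.
have h1 := cvgto_ip hH (cvgto_bnd hH hH lA bA (hU c z)) (hU c' z').
have h2 := ccvg_mull (b c c') (cvgto_ip hZ (he.2 z) (he.2 z')).
apply: ccvg_le (ccvg_sub h1 h2) _ => n.
rewrite (ip_proj_proj hZ _ _ (he.1 n)) (lin_sum _ _ _ lA) ip_suml // mulr_sumr -sumrB.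
apply: le_trans (cmod_sum _ _ _) _.
have -> : 4 * eta * hnorm ipZ z * hnorm ipZ z' =
  2 * (2 * (eta * hnorm ipZ z * hnorm ipZ z')) by ring.
set K := eta * _ * _; have K0 : 0 <= K by rewrite !mulr_ge0 ?hnorm_ge0.
apply: (@le_trans _ _ (\sum_(k < n) 2^-1 ^+ k * (2 * K))); last first.
  by rewrite -mulr_suml ler_wpM2r ?sum_half_powers // mulr_ge0.
apply: ler_sum => k _.
have -> : ipH (A (ipZ z (e k) *: u c k)) (\sum_(k0 < n) ipZ z' (e k0) *: u c' k0)
    - b c c' * (ipZ z (e k) * (ipZ z' (e k))^*)
  = \sum_(k' < n) ipZ z (e k) * (ipZ z' (e k'))^*
      * (ipH (A (u c k)) (u c' k') - b c c' * (k == k' :> nat)%:R).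
  rewrite linZ // ip_sumr //; under [in RHS]eq_bigr do rewrite mulrBr.
  rewrite sumrB; congr (_ - _).
    by apply: eq_bigr => k' _; rewrite ipZl // ipZr // mulrA.
  rewrite (bigD1 k) //= eqxx mulr1 big1 ?addr0 ?[b c c' * _]mulrC // => i ik.
  by rewrite eq_sym (negPf (_ : i != k :> nat)) ?mulr0.
apply: le_trans (cmod_sum _ _ _) _.
apply: (@le_trans _ _ (\sum_(k' < n) 2^-1 ^+ k' * (2^-1 ^+ k * K))); last first.
  rewrite -mulr_suml [leRHS]mulrCA ler_wpM2r ?sum_half_powers // mulr_ge0 //.
  by rewrite exprn_ge0 // invr_ge0.
apply: ler_sum => k' _; rewrite !cmodM cmodJ.
have -> : 2^-1 ^+ k' * (2^-1 ^+ k * K) =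
  hnorm ipZ z * hnorm ipZ z' * (eta * 2^-1 ^+ k * 2^-1 ^+ k') by rewrite /K; ring.
apply: ler_pM; rewrite ?mulr_ge0 ?cmod_ge0 //.
by apply: ler_pM; rewrite ?cmod_ge0 ?basis_coef_le.
Qed.

(** The case of the identity operator with error eta = 0 in [embedding_form]. *)
Lemma embedding_ip c c' z z' : ipH (U c z) (U c' z') = (c == c')%:R * ipZ z z'.
Proof.
have lid : is_linear (@id H) by [].
have bid : bnd ipH ipH 1 id by move=> x; rewrite mul1r.
have := embedding_form (b := fun c c' => (c == c')%:R) (c := c) (c' := c')
  lid bid (lexx 0) _ z z'.
rewrite !(mulr0, mul0r) => h; apply/subr0_eq/cmod_eq0/eqP.
rewrite eq_le cmod_ge0 andbT; apply: h => k k'.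
by rewrite ou -natrM mulnb subrr cmod0 !mul0r.
Qed.

End Embeddings.

(** * Inductive selection of vectors with prescribed diagonal entries *)

Section Selection.
Variables (R : realType) (H : lmodType R[i]) (ip : H -> H -> R[i]).
Hypothesis hip : inner_product_axioms ip.
Local Notation nm := (hnorm ip).
Variables (L : finType) (A : L -> H -> H).
Hypothesis hA : forall l, bounded_op ip ip (A l).

Lemma common_bound : exists2 alpha : R, 0 <= alpha & forall l, bnd ip ip alpha (A l).
Proof.
have [c hc] := choice (fun l => (hA l).2).
exists (\sum_l `|c l|) => [|l x]; first by apply: sumr_ge0.
apply: le_trans (hc l x) _; rewrite ler_wpM2r ?hnorm_ge0 // (bigD1 l) //=.
by rewrite (le_trans (ler_norm _)) // lerDl sumr_ge0.
Qed.

(** Let w be an orthonormal sequence realizing lam. Being weakly null, a late term is almost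
    orthogonal to each u i and satisfies the bounds involving A l up to eta / 2. Removing its
    projection on the u i and normalizing moves it by at most 2 tau. *)
Lemma select_step (u : nat -> H) n l0 (lam : R[i]) (eta : R) :
  (forall i j, (i < n)%N -> (j < n)%N -> ip (u i) (u j) = (i == j)%:R) ->
  ess_num_range ip (A l0) lam -> 0 < eta ->
  exists v, [/\ ip v v = 1, forall i, (i < n)%N -> ip v (u i) = 0,
    cmod (ip (A l0 v) v - lam) <= eta &
    forall l i, (i < n)%N -> cmod (ip (A l v) (u i)) <= eta /\
      cmod (ip (A l (u i)) v) <= eta].
Proof.
move=> ou [w [ow hw]] eta0; have [alpha a0 hal] := common_bound.
have uz : orthonormal_or_zero ip u n.
  split=> [i j ni nj ij|i ni]; first by rewrite ou // (negPf ij).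
  by right; rewrite ou // eqxx.
pose tau := Num.min 2^-1 (eta / (8 * (alpha + 1))).
have al1 : 0 < 8 * (alpha + 1) by rewrite mulr_gt0 // ltr_wpDl.
have tau0 : 0 < tau by rewrite lt_min invr_gt0 ltr0Sn divr_gt0.
have tau2 : tau <= 2^-1 by rewrite ge_min lexx.
have taue : tau * (8 * (alpha + 1)) <= eta.
  by rewrite -ler_pdivlMr // ge_min lexx orbT.
have eta2 : 0 < eta / 2 by rewrite divr_gt0.
have nu i : (i < n)%N -> nm (u i) = 1.
  move=> ni; rewrite /hnorm ou // eqxx /=; exact: sqrtr1.
have nw i : nm (w i) = 1 by rewrite /hnorm ow eqxx /=; exact: sqrtr1.
(* There are n coefficients to control; the successor avoids a division by zero when n = 0. *)
have n1 : 0 < tau / n.+1%:R by rewrite divr_gt0.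
have wn g c : 0 <= c -> (forall a x y, g (a *: x + y) = a * g x + g y) ->
    (forall x, cmod (g x) <= c * nm x) -> forall d, 0 < d ->
    for_large_n (fun m => cmod (g (w m)) < d).
  move=> c0 lg bg d d0; have [N hN] := weakly_null hip ow c0 lg bg d0.
  by exists N => m /hN; rewrite subr0.
have e1 : for_large_n (fun m => forall i : 'I_n, cmod (ip (w m) (u i)) < tau / n.+1%:R).
  apply: for_large_n_forall => i.
  have [|x|N hN] := wn (fun x => ip x (u i)) 1 ler01 _ _ _ n1.
  - by move=> a x y; rewrite ip_lin.
  - by apply: le_trans (cauchy_schwarz hip _ _) _; rewrite nu // mulr1 mul1r.
  by exists N.
have e2 : for_large_n (fun m => forall p : L * 'I_n,
    cmod (ip (A p.1 (w m)) (u p.2)) < eta / 2).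
  apply: for_large_n_forall => -[l i] /=.
  have [|x|N hN] := wn (fun x => ip (A l x) (u i)) alpha a0 _ _ _ eta2.
  - by move=> a x y; rewrite (hA l).1 ip_lin.
  - by apply: le_trans (cauchy_schwarz hip _ _) _; rewrite nu // mulr1; exact: hal.
  by exists N.
have e3 : for_large_n (fun m => forall p : L * 'I_n,
    cmod (ip (A p.1 (u p.2)) (w m)) < eta / 2).
  apply: for_large_n_forall => -[l i] /=.
  have [|x|N hN] := wn (fun x => ip x (A l (u i))) alpha a0 _ _ _ eta2.
  - by move=> a x y; rewrite ip_lin.
  - apply: le_trans (cauchy_schwarz hip _ _) _; rewrite mulrC ler_wpM2r ?hnorm_ge0 //.
    by have := hal l (u i); rewrite nu // mulr1.
  by exists N => m /hN; rewrite [ip _ (w m)]ipC // cmodJ.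
have [M hM] := for_large_n_and (for_large_n_and e1 e2) (for_large_n_and e3 (hw _ eta2)).
have [[{}e1 {}e2] [{}e3 e4]] := hM _ (leqnn M); move: (w M) (nw M) e1 e2 e3 e4.
move=> x nx e1 e2 e3 e4 {hM wn hw ow nw w}.
pose p := ortho_proj ip u n x; pose y := x - p.
have np : nm p <= tau.
  apply: le_trans (hnorm_sum hip _ _ _) _.
  apply: (@le_trans _ _ (\sum_(k < n) tau / n.+1%:R)).
    by apply: ler_sum => k _; rewrite hnormZ // nu // mulr1 ltW.
  rewrite sumr_const card_ord -[leLHS]mulr_natr mulrAC ler_pdivrMr ?ltr0Sn //.
  by rewrite ler_wpM2l ?ler_nat // ltW.
have ny1 := hnorm_dist hip x p; have ny2 := hnormB hip x p.
rewrite -/y nx in ny1 ny2.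
have ny0 : 0 < nm y by lra.
pose v := (nm y)^-1%:C *: y.
have nv : ip v v = 1.
  rewrite /v ipZl // ipZr // ipxx // conjc_real -!rmorphM /=.
  by congr (_%:C); field; rewrite gt_eqF.
have nv1 : nm v = 1 by rewrite /hnorm nv; exact: sqrtr1.
have vy : nm (v - y) <= tau.
  have -> : v - y = ((nm y)^-1 - 1)%:C *: y by rewrite rmorphB scalerBl scale1r.
  rewrite hnormZ // cmodR -{2}(ger0_norm (ltW ny0)) -normrM mulrBl mulVf ?gt_eqF //.
  by rewrite mul1r ler_norml; apply/andP; split; lra.
have vx : nm (v - x) <= 2 * tau.
  have := hnorm_dist_trans hip v y x; rewrite [nm (y - x)]hnormBC //.
  by rewrite (subKr x p : x - y = p); lra.
have a1 l z : nm z = 1 -> cmod (ip (A l v) z) <= cmod (ip (A l x) z) + alpha * (2 * tau).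
  move=> nz; have -> : ip (A l v) z = ip (A l x) z + ip (A l (v - x)) z.
    by rewrite (linB _ _ (hA l).1) ipBl //; ring.
  apply: le_trans (cmodD _ _) _; rewrite lerD2l.
  apply: le_trans (cauchy_schwarz hip _ _) _; rewrite nz mulr1.
  by apply: le_trans (hal l _) _; rewrite ler_wpM2l.
exists v; split=> //.
- by move=> i ni; rewrite ipZl // proj_orth // mulr0.
- have -> : ip (A l0 v) v - lam = (ip (A l0 x) x - lam)
     + (ip (A l0 (v - x)) v + ip (A l0 x) (v - x)).
    by rewrite (linB _ _ (hA l0).1) ipBl // ipBr //; ring.
  have := cmodD (ip (A l0 x) x - lam) (ip (A l0 (v - x)) v + ip (A l0 x) (v - x)).
  have := cmodD (ip (A l0 (v - x)) v) (ip (A l0 x) (v - x)).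
  have := cauchy_schwarz hip (A l0 (v - x)) v; rewrite nv1.
  have := cauchy_schwarz hip (A l0 x) (v - x).
  have := hal l0 (v - x); have := hal l0 x; rewrite nx => h1 h2 h3 h4 h5 h6.
  have : nm (A l0 x) * nm (v - x) <= alpha * (2 * tau).
    by apply: ler_pM; rewrite ?hnorm_ge0 //; lra.
  have : alpha * nm (v - x) <= alpha * (2 * tau) by rewrite ler_wpM2l.
  nra.
- move=> l i ni; split.
    have := a1 l (u i) (nu i ni); have := e2 (l, Ordinal ni) => /=; nra.
  have -> : ip (A l (u i)) v = ip (A l (u i)) x + ip (A l (u i)) (v - x).
    by rewrite ipBr //; ring.
  have := cmodD (ip (A l (u i)) x) (ip (A l (u i)) (v - x)).
  have := cauchy_schwarz hip (A l (u i)) (v - x).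
  have := e3 (l, Ordinal ni) => /=; have := hal l (u i); rewrite nu // => h1 h2 h3 h4.
  have : nm (A l (u i)) * nm (v - x) <= alpha * (2 * tau).
    by apply: ler_pM; rewrite ?hnorm_ge0 //; lra.
  nra.
Qed.

Lemma select_sequence (idx : nat -> L) (lam : nat -> R[i]) (eta : nat -> R) :
  (forall a, ess_num_range ip (A (idx a)) (lam a)) -> (forall a, 0 < eta a) ->
  exists u, orthonormal_seq ip u /\ forall a,
    cmod (ip (A (idx a) (u a)) (u a) - lam a) <= eta a /\
    forall l b, (b < a)%N ->
      cmod (ip (A l (u a)) (u b)) <= eta a /\ cmod (ip (A l (u b)) (u a)) <= eta a.
Proof.
move=> hl he.
pose on (u : nat -> H) n := forall i j, (i < n)%N -> (j < n)%N ->
  ip (u i) (u j) = (i == j)%:R.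
pose G n u (v : H) := on u n -> [/\ ip v v = 1, forall i, (i < n)%N -> ip v (u i) = 0,
    cmod (ip (A (idx n) v) v - lam n) <= eta n &
    forall l i, (i < n)%N -> cmod (ip (A l v) (u i)) <= eta n /\
      cmod (ip (A l (u i)) v) <= eta n].
have [n u|n u u' v uu' h ou'|u hu] := recursive_choice (0 : H) (G := G).
- have [ou|nou] := pselect (on u n); last by exists 0.
  by have [v hv] := select_step ou (hl n) (he n); exists v.
- have [|h1 h2 h3 h4] := h; first by move=> i j ni nj; rewrite !uu' // ou'.
  split=> // [i ni|l i ni]; first by rewrite -uu' // h2.
  by rewrite -uu' //; exact: h4.
have ou n : on u n.
  elim: n => [|n IH] i j //; have [h1 h2 _ _] := hu n IH.
  rewrite !ltnS [(i <= n)%N]leq_eqVlt [(j <= n)%N]leq_eqVlt.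
  move=> /predU1P[->|ni] /predU1P[->|nj]; first by rewrite eqxx.
  - by rewrite h2 // gtn_eqF.
  - by rewrite ipC // h2 // ltn_eqF // conjc0.
  - exact: IH.
exists u; split=> [i j|a].
  by apply: (ou (maxn i j).+1); rewrite ltnS ?leq_maxl ?leq_maxr.
by have [_ _ h3 h4] := hu a (ou a).
Qed.

(** All families are interleaved in one sequence, with [cod c k] the position of the k-th vector of
    family c. A family is compared with a diagonal only for its own operator, but distinct families
    are nearly uncoupled by every A l, which is what gluing requires. *)
Lemma select_family (I : finType) (idx : I -> L) (lam : I -> R[i]) (eta : R) :
  (forall c, ess_num_range ip (A (idx c)) (lam c)) -> 0 < eta ->
  exists u : I -> nat -> H,
    (forall c c' k k', ip (u c k) (u c' k') = ((c == c') && (k == k'))%:R) /\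
    forall l c c' k k', (c == c' -> l = idx c) ->
      cmod (ip (A l (u c k)) (u c' k') - (c == c')%:R * lam c * (k == k')%:R)
        <= eta * 2^-1 ^+ k * 2^-1 ^+ k'.
Proof.
move=> hl he.
have [i0|] := pselect (exists c : I, True); last first.
  by move=> nI; exists (fun _ _ => 0); split=> [c|l c]; case: nI; exists c.
have {i0} cI : (0 < #|I|)%N by case: i0 => c _; apply/card_gt0P; exists c.
pose dec a : I := enum_val (Ordinal (ltn_pmod a cI)).
pose cod (c : I) k := (k * #|I| + enum_rank c)%N.
have decK c k : dec (cod c k) = c.
  rewrite /dec -[RHS](enum_rankK c); congr enum_val; apply: val_inj => /=.
  by rewrite modnMDl modn_small.
have codI c c' k k' : (cod c k == cod c' k') = (c == c') && (k == k').
  apply/eqP/andP => [h|[/eqP-> /eqP->]//].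
  have cc : c = c' by rewrite -(decK c k) h decK.
  by move: h; rewrite cc eqxx => /addIn/eqP; rewrite eqn_pmul2r.
have cod_ge c k : (k <= cod c k)%N by rewrite (leq_trans (leq_pmulr k cI)) ?leq_addr.
(* A position is at least as large as its index k, so the tolerance 4^-a at the later of two
   positions is below 2^-k 2^-k'. *)
have e0 a : 0 < eta * 4^-1 ^+ a by rewrite mulr_gt0 // exprn_gt0 // invr_gt0.
have [u [ou hu]] := select_sequence (fun a => hl (dec a)) e0.
exists (fun c k => u (cod c k)); split=> [c c' k k'|]; first by rewrite ou codI.
have hp m n : (m <= n)%N -> (2^-1 : R) ^+ n <= 2^-1 ^+ m.
  by move=> h; apply: ler_wiXn2l => //; lra.
have key a k k' : (k <= a)%N -> (k' <= a)%N ->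
    eta * 4^-1 ^+ a <= eta * 2^-1 ^+ k * 2^-1 ^+ k'.
  move=> h1 h2; rewrite -mulrA ler_wpM2l // ?(ltW he) //.
  have -> : 4^-1 ^+ a = 2^-1 ^+ a * 2^-1 ^+ a :> R by rewrite -exprMn; congr (_ ^+ _); lra.
  by apply: ler_pM; rewrite ?exprn_ge0 ?invr_ge0 ?hp.
move=> l c c' k k' hc.
(* Whichever vector of the pair was selected later carries the estimate. *)
have [h|h|/eqP h] := ltngtP (cod c k) (cod c' k'); last first.
- move: h; rewrite codI => /andP[/eqP ? /eqP ?]; subst c' k'.
  rewrite !eqxx mul1r mulr1 (hc (eqxx _)).
  by have [+ _] := hu (cod c k); rewrite decK => /le_trans; apply; exact: key.
- have := codI c c' k k'; rewrite gtn_eqF // => /esym/negbT.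
  rewrite negb_and => hcc; have -> : (c == c')%:R * lam c * (k == k')%:R = 0 :> R[i].
    by case/orP: hcc => /negPf ->; rewrite ?mulr0 ?mul0r.
  rewrite subr0; have [_ /(_ l _ h)[h2 _]] := hu (cod c k).
  apply: le_trans h2 _; apply: key => //.
  by rewrite (leq_trans (cod_ge c' k')) // ltnW.
- have := codI c c' k k'; rewrite ltn_eqF // => /esym/negbT.
  rewrite negb_and => hcc; have -> : (c == c')%:R * lam c * (k == k')%:R = 0 :> R[i].
    by case/orP: hcc => /negPf ->; rewrite ?mulr0 ?mul0r.
  rewrite subr0; have [_ /(_ l _ h)[_ h2]] := hu (cod c' k').
  apply: le_trans h2 _; apply: key => //.
  by rewrite (leq_trans (cod_ge c k)) // ltnW.
Qed.

End Selection.

(** * The shift model of a strict contraction *)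

Lemma geometric_derivative_bound (R : realType) (q : R) n : 0 <= q -> q < 1 ->
  \sum_(k < n) k.+1%:R * q ^+ k <= (1 - q)^-1 ^+ 2.
Proof.
move=> q0 q1; have q1' : 1 - q != 0 by rewrite subr_eq0 eq_sym lt_eqF.
have -> : \sum_(k < n) k.+1%:R * q ^+ k
    = (1 - q)^-1 ^+ 2 * (1 - n.+1%:R * q ^+ n + n%:R * q ^+ n.+1).
  elim: n => [|n IH]; first by rewrite big_ord0 expr0 mul0r mulr1 subrr addr0 mulr0.
  rewrite big_ord_recr /= IH !exprS -!natr1; field.
  by rewrite q1'.
rewrite -[leRHS]mulr1 ler_wpM2l ?sqr_ge0 // exprS -natr1.
have x0 : 0 <= q ^+ n by rewrite exprn_ge0.
have : 0 <= n%:R * q ^+ n * (1 - q) by rewrite !mulr_ge0 // subr_ge0 ltW.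
set x := q ^+ n in x0 *; set m := n%:R; nra.
Qed.

(** The quantity (n+1) q^n is the Lipschitz constant of X |-> X^(n+1) on the ball of radius q, so
    long powers are insensitive to X. It tends to 0 as the general term of a convergent series. *)
Lemma geometric_derivative_small (R : realType) (q e : R) : 0 <= q -> q < 1 ->
  0 < e -> exists N, forall n, (N <= n)%N -> n.+1%:R * q ^+ n < e.
Proof.
move=> q0 q1 e0.
have a0 k : 0 <= k.+1%:R * q ^+ k by rewrite mulr_ge0 // exprn_ge0.
have [N hN] := bounded_series_cauchy a0
  (fun n => geometric_derivative_bound n q0 q1) e0.
by exists N => n /hN/(_ (leqnSn n)); rewrite big_nat1.
Qed.

Definition sesquilinear (R : realType) (V : lmodType R[i]) (F : V -> V -> R[i]) :=
  (forall a x y z, F (a *: x + y) z = a * F x z + F y z) /\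
  (forall a x y z, F z (a *: x + y) = a^* * F z x + F z y).

Section SesquilinearForms.
Variables (R : realType) (V : lmodType R[i]) (ip : V -> V -> R[i]).
Hypothesis hip : inner_product_axioms ip.
Local Notation nm := (hnorm ip).
Local Notation bnd := (bnd ip ip).
Implicit Types (F : V -> V -> R[i]) (P Q : V -> V).

Definition form_bnd (c : R) F := forall x y, cmod (F x y) <= c * nm x * nm y.

Lemma sesquilinear_ip : sesquilinear ip.
Proof. by split=> a x y z; rewrite ?ip_lin // ipDr // ipZr. Qed.

Lemma sesquilinearBl F x y z : sesquilinear F -> F (x - y) z = F x z - F y z.
Proof. by move=> [h _]; rewrite addrC -scaleN1r h mulN1r addrC. Qed.

Lemma sesquilinearBr F x y z : sesquilinear F -> F z (x - y) = F z x - F z y.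
Proof. by move=> [_ h]; rewrite addrC -scaleN1r h rmorphN1 mulN1r addrC. Qed.

Lemma form_comp_dist F P P' Q Q' (c p dp q dq : R) : sesquilinear F ->
  0 <= c -> 0 <= p -> 0 <= dp -> form_bnd c F ->
  bnd dp (fun x => P x - P' x) -> bnd q Q -> bnd p P' ->
  bnd dq (fun x => Q x - Q' x) ->
  form_bnd (c * (dp * q + p * dq)) (fun x y => F (P x) (Q y) - F (P' x) (Q' y)).
Proof.
move=> sF c0 p0 dp0 bF bP bQ bP' bQ' x y.
have -> : F (P x) (Q y) - F (P' x) (Q' y)
    = F (P x - P' x) (Q y) + F (P' x) (Q y - Q' y).
  by rewrite sesquilinearBl // sesquilinearBr //; ring.
apply: le_trans (cmodD _ _) _.
have -> : c * (dp * q + p * dq) * nm x * nm y =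
  c * ((dp * nm x) * (q * nm y)) + c * ((p * nm x) * (dq * nm y)) by ring.
apply: lerD; apply: le_trans (bF _ _) _; rewrite -mulrA ler_wpM2l //;
  by apply: ler_pM; rewrite ?hnorm_ge0.
Qed.

Lemma form_bnd_le F (c d : R) : c <= d -> form_bnd c F -> form_bnd d F.
Proof.
by move=> h hF x y; apply: le_trans (hF x y) _; rewrite !ler_wpM2r ?hnorm_ge0.
Qed.

Lemma form_bndD F G (c d : R) : form_bnd c F -> form_bnd d G ->
  form_bnd (c + d) (fun x y => F x y + G x y).
Proof.
move=> hF hG x y; apply: le_trans (cmodD _ _) _.
by rewrite !mulrDl lerD.
Qed.

Lemma form_bndN F (c : R) : form_bnd c F -> form_bnd c (fun x y => - F x y).
Proof. by move=> hF x y; rewrite cmodN. Qed.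

Lemma form_bndZ F a (c : R) : form_bnd c F ->
  form_bnd (cmod a * c) (fun x y => a * F x y).
Proof. by move=> hF x y; rewrite cmodM -!mulrA ler_wpM2l ?cmod_ge0 // mulrA. Qed.

Lemma form_bnd_sum n (F : 'I_n -> V -> V -> R[i]) (c : R) :
  (forall i, form_bnd c (F i)) ->
  form_bnd (n%:R * c) (fun x y => \sum_(i < n) F i x y).
Proof.
move=> hF x y; apply: le_trans (cmod_sum _ _ _) _.
apply: (@le_trans _ _ (\sum_(i < n) c * nm x * nm y)).
  by apply: ler_sum => i _; exact: hF.
by rewrite sumr_const card_ord -[leLHS]mulr_natl !mulrA.
Qed.

Lemma form_bnd_operator P (c : R) : 0 <= c ->
  form_bnd c (fun x y => ip (P x) y) -> bnd c P.
Proof.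
by move=> c0 h x; apply: (hnorm_dual hip) => [|y]; rewrite ?mulr_ge0 ?hnorm_ge0 ?h.
Qed.

End SesquilinearForms.

(** * The contraction principle for operators *)

Section FixedPoint.
Variables (R : realType) (Z : lmodType R[i]) (ip : Z -> Z -> R[i]).
Hypothesis hip : inner_product_axioms ip.
Hypothesis cZ : complete_space ip.
Local Notation nm := (hnorm ip).
Local Notation bnd := (bnd ip ip).

Lemma linear_limit (u : nat -> Z -> Z) X : (forall n, is_linear (u n)) ->
  (forall z, cvgto ip (fun n => u n z) (X z)) -> is_linear X.
Proof.
move=> lu hu a x y; apply: (cvgto_uniq hip (hu _)).
have h := cvgto_lin hip a (hu x) (hu y).
by move=> e e0; have [N hN] := h e e0; exists N => n /hN; rewrite lu.
Qed.

Lemma bnd_limit (u : nat -> Z -> Z) X c : (forall n, bnd c (u n)) ->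
  (forall z, cvgto ip (fun n => u n z) (X z)) -> bnd c X.
Proof.
move=> bu hu z; rewrite -[X z]subr0; apply: (cvgto_le hip (hu z)) => n.
by rewrite subr0; exact: bu.
Qed.

(** Distances are measured by operator bounds, but completeness is only needed pointwise: the
    iterates converge at every vector, and P is assumed closed under pointwise limits. The geometric
    rate, uniform up to |z|, carries the contraction estimate to the limit. *)
Lemma contraction_fixed_point (P : (Z -> Z) -> Prop) (Psi : (Z -> Z) -> Z -> Z)
    X0 (k c : R) : 0 <= k -> k < 1 -> 0 <= c ->
  P X0 -> (forall X, P X -> P (Psi X)) ->
  (forall X X' d, 0 <= d -> P X -> P X' -> bnd d (fun z => X z - X' z) ->
     bnd (k * d) (fun z => Psi X z - Psi X' z)) ->
  (forall (u : nat -> Z -> Z) X, (forall n, P (u n)) ->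
     (forall z, cvgto ip (fun n => u n z) (X z)) -> P X) ->
  bnd c (fun z => Psi X0 z - X0 z) ->
  exists2 X, P X & forall z, Psi X z = X z.
Proof.
move=> k0 k1 c0 P0 PPsi hPsi cP h0.
have k1' : 0 < 1 - k by rewrite subr_gt0.
pose u n := iter n Psi X0; pose C := c / (1 - k).
have C0 : 0 <= C by rewrite divr_ge0 // ltW.
have Pu n : P (u n) by elim: n => //= n; exact: PPsi.
have du n : bnd (k ^+ n * c) (fun z => u n.+1 z - u n z).
  elim: n => [|n IH]; first by rewrite expr0 mul1r.
  rewrite exprS -mulrA; apply: (hPsi (u n.+1) (u n) _ _ (Pu _) (Pu _) IH).
  by rewrite mulr_ge0 // exprn_ge0.
(* The factor 1 - k^j comes from the partial geometric sum; keeping it lets the induction close with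
   equality. *)
have duk m j : bnd (k ^+ m * C * (1 - k ^+ j)) (fun z => u (m + j)%N z - u m z).
  elim: j => [|j IH] z.
    by rewrite addn0 subrr hnorm0 // expr0 subrr mulr0 mul0r.
  apply: le_trans (hnorm_dist_trans hip _ (u (m + j)%N z) _) _.
  apply: le_trans (lerD (_ : _ <= k ^+ (m + j) * c * nm z) (IH z)) _.
    by rewrite addnS; exact: du.
  rewrite le_eqVlt; apply/orP; left; apply/eqP.
  by rewrite /C exprD exprS; field; rewrite gt_eqF.
have dum m n : (m <= n)%N -> bnd (k ^+ m * C) (fun z => u n z - u m z).
  move=> mn z; rewrite -(subnKC mn); apply: le_trans (duk m (n - m)%N z) _.
  rewrite ler_wpM2r ?hnorm_ge0 // ler_piMr //.
    by rewrite mulr_ge0 // exprn_ge0.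
  by rewrite gerBl exprn_ge0.
clearbody C.
have small (e : R) : 0 < e -> exists N, forall n, (N <= n)%N -> k ^+ n < e.
  move=> e0; have [N hN] := geometric_derivative_small k0 k1 e0.
  exists N => n /hN; apply: le_lt_trans.
  by rewrite ler_peMl ?exprn_ge0 // ler1n.
have ex z : exists l, cvgto ip (fun n => u n z) l.
  apply: cZ => e e0; have D0 : 0 < 2 * (C * nm z + 1).
    by rewrite mulr_gt0 // ltr_wpDl // mulr_ge0 // hnorm_ge0.
  have [|N hN] := small (e / (2 * (C * nm z + 1))); first by rewrite divr_gt0.
  have key n : (N <= n)%N -> nm (u n z - u N z) < e / 2.
    move=> /dum/(_ z) h; have := hN _ (leqnn N); rewrite ltr_pdivlMr //.
    have := exprn_ge0 N k0; have := hnorm_ge0 ip z; set x := k ^+ N in h *.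
    by move: h; rewrite -mulrA; set y := C * nm z; nra.
  exists N => m n hm hn; apply: le_lt_trans (hnorm_dist_trans hip _ (u N z) _) _.
  by have := key m hm; have := key n hn; rewrite hnormBC //; lra.
have [X hX] := choice ex; have PX : P X by exact: cP Pu hX.
have dX m : bnd (k ^+ m * C) (fun z => u m z - X z).
  move=> z /=; rewrite hnormBC //.
  have h1 : cvgto ip (fun n => u (n + m)%N z) (X z).
    move=> e e0; have [N hN] := hX z e e0; exists N => n Nn.
    by apply: hN; rewrite (leq_trans Nn) // leq_addr.
  by apply: (cvgto_le hip h1) => n; apply: dum; exact: leq_addl.
(* Both X and Psi X are close to u (N+1) = Psi (u N). *)
exists X => // z; apply/subr0_eq/(hnorm_eq0 hip)/eqP; rewrite eq_le hnorm_ge0 andbT.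
apply/ler_addgt0Pr => e e0; rewrite add0r.
have D0 : 0 < 2 * (C * nm z + 1).
  by rewrite mulr_gt0 // ltr_wpDl // mulr_ge0 // hnorm_ge0.
have [|N hN] := small (e / (2 * (C * nm z + 1))); first by rewrite divr_gt0.
have := hN _ (leqnn N); rewrite ltr_pdivlMr // => h.
have h1 := hPsi _ _ _ (mulr_ge0 (exprn_ge0 N k0) C0) (Pu N) PX (dX N) z.
have h2 := dX N.+1 z; have h3 := hnorm_dist_trans hip (Psi X z) (Psi (u N) z) (X z).
rewrite [nm (Psi X z - Psi (u N) z)]hnormBC // in h3.
move: h1 h2; rewrite exprS /= -/(u N).
have := exprn_ge0 N k0; have := hnorm_ge0 ip z; set x := k ^+ N in h *.
have : 0 <= C * nm z by rewrite mulr_ge0 ?hnorm_ge0.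
rewrite -!mulrA; set y := C * nm z => y0 nz x0 h1 h2.
have hk : k * (x * y) <= x * y by rewrite ler_piMl ?mulr_ge0 // ltW.
have := le_trans h1 hk; have := le_trans h2 hk => {}h2 {}h1.
have : x * y + x * y + 2 * x < e by rewrite (_ : _ + _ = x * (2 * (y + 1))) //; ring.
lra.
Qed.

End FixedPoint.

(** * The defect operator and the truncated shift model *)

Section Defect.
Variables (R : realType) (Z : lmodType R[i]) (ip : Z -> Z -> R[i]).
Hypothesis hZ : separable_hilbert ip.
Local Notation nm := (hnorm ip).
Local Notation bnd := (bnd ip ip).
Variables (q : R) (q0 : 0 <= q) (q1 : q < 1).
Let hip : inner_product_axioms ip. Proof. by case: hZ. Qed.

Definition in_ball X := is_linear X /\ bnd q X.

(* [2 Y = X^* X + Y^2] says that [(1 - Y)^2 = 1 - X^* X]. *)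
Definition half_defect (X Y : Z -> Z) :=
  [/\ is_linear Y, bnd q Y, (forall z z', ip (Y z) z' = ip z (Y z')) &
   forall z z', 2 * ip (Y z) z' = ip (X z) (X z') + ip (Y z) (Y z')].

(** Y is a fixed point of Y |-> (X^* X + Y^2) / 2. This preserves the ball of radius q since q^2 <=
    q, and contracts by q there because Y^2 - Y'^2 = Y (Y - Y') + (Y - Y') Y'. Then 1 - Y is the
    wanted square root. *)
Lemma half_defect_exists X : in_ball X -> exists Y, half_defect X Y.
Proof.
move=> [lX bX]; have [iZ cZ sZ] := hZ.
have [|a w w' z|a w z z'|w z|M [lM bM hM]] :=
    @sesquilinear_operator _ _ _ ip _ hZ (fun z z' => ip (X z) (X z')) (q ^+ 2).
- exact: sqr_ge0.
- by rewrite lX ip_lin.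
- by rewrite lX ipDr // ipZr.
- apply: le_trans (cauchy_schwarz hip _ _) _.
  rewrite (_ : q ^+ 2 * nm w * nm z = (q * nm w) * (q * nm z)); last by ring.
  by apply: ler_pM; rewrite ?hnorm_ge0.
pose P Y := [/\ is_linear Y, bnd q Y & forall z z', ip (Y z) z' = ip z (Y z')].
pose Psi Y z := (2^-1)%:C *: (M z + Y (Y z)) : Z.
have c2 : cmod (2^-1)%:C = 2^-1 :> R by rewrite cmodR ger0_norm // invr_ge0.
have bY Y z : bnd q Y -> nm (Y (Y z)) <= q * (q * nm z).
  by move=> bY; apply: le_trans (bY _) _; rewrite ler_wpM2l.
have [| | | | |Y [lY bY' sY] YE] :=
    @contraction_fixed_point _ _ _ hip cZ P Psi (fun=> 0) q q q0 q1 q0.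
- split=> [a x y|z|z z']; first by rewrite scaler0 addr0.
    by rewrite hnorm0 // mulr_ge0 // hnorm_ge0.
  by rewrite ip0l // ip0r.
- move=> Y [lY bY' sY]; split=> [a x y|z|z z'].
  + rewrite /Psi lM !lY addrACA -scalerDr [LHS]scalerDr !scalerA.
    congr (_ *: _ + _); exact: mulrC.
  + rewrite /Psi hnormZ // c2; have := hnormD hip (M z) (Y (Y z)).
    have := bM z; have := bY _ z bY'; have := hnorm_ge0 ip z.
    have : q * q * nm z <= q * nm z by rewrite ler_wpM2r ?hnorm_ge0 // ler_piMl // ltW.
    by rewrite expr2; lra.
  + rewrite /Psi ipZl // ipZr // conjc_real ipDl // ipDr // hM sY sY.
    by rewrite [ip z (M z')]ipC // hM -ipC.
- move=> X1 X2 d d0 [l1 b1 s1] [l2 b2 s2] h z.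
  have -> : Psi X1 z - Psi X2 z = (2^-1)%:C *: (X1 (X1 z - X2 z) + (X1 (X2 z) - X2 (X2 z))).
    by rewrite -scalerBr (linB _ _ l1) addrA subrK opprD addrACA subrr add0r.
  rewrite hnormZ // c2.
  have := hnormD hip (X1 (X1 z - X2 z)) (X1 (X2 z) - X2 (X2 z)).
  have := b1 (X1 z - X2 z); have := h (X2 z); have := b2 z; have := h z.
  have : d * nm (X2 z) <= d * (q * nm z) by rewrite ler_wpM2l.
  have : q * nm (X1 z - X2 z) <= q * (d * nm z) by rewrite ler_wpM2l //; exact: h.
  by nra.
- move=> u X' Pu hu; split.
  + by apply: (linear_limit hip (u := u)) => // n; case: (Pu n).
  + by apply: (bnd_limit hip (u := u)) => // n; case: (Pu n).
  + move=> z z'; apply: (ccvg_uniq (cvgto_ip hip (hu z) (cvgto_cst hip z'))).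
    have h := cvgto_ip hip (cvgto_cst hip z) (hu z').
    move=> e e0; have [N hN] := h e e0; exists N => n /hN.
    by have [_ _ ->] := Pu n.
- move=> z; rewrite /Psi subr0 addr0 hnormZ // c2.
  have := bM z; have := hnorm_ge0 ip z; have := hnorm_ge0 ip (M z).
  have : q ^+ 2 * nm z <= q * nm z.
    by rewrite expr2 ler_wpM2r ?hnorm_ge0 // ler_piMl // ltW.
  by lra.
exists Y; split=> // z z'; rewrite -hM -[in RHS]sY -{1}YE /Psi ipZl // ipDl //.
rewrite -[2]/(2%:R) mulrA (_ : 2%:R * (2^-1)%:C = 1 :> R[i]) ?mul1r //.
by rewrite -(rmorph_nat (real_complex R)) -rmorphM /= divff // pnatr_eq0.
Qed.

(** Subtracting the two equations gives N <= q d + q N for the norm N of Y - Y'. Absorbing the last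
    term needs N finite, hence the passage through [opnorm]. *)
Lemma half_defect_dist X X' Y Y' d : in_ball X -> in_ball X' ->
  half_defect X Y -> half_defect X' Y' -> 0 <= d ->
  bnd d (fun z => X z - X' z) -> bnd (d / (1 - q)) (fun z => Y z - Y' z).
Proof.
move=> [lX bX] [lX' bX'] [lY bY sY eY] [lY' bY' sY' eY'] d0 hd.
have bo : bounded_op ip ip (fun z => Y z - Y' z).
  by apply: bounded_op_sub => //; split => //; exists q.
have bN := bounded_opP hip hip bo; have N0 := opnorm_ge0 hip hip bo.
set N := opnorm _ _ _ in bN N0.
have q1' : 0 < 1 - q by rewrite subr_gt0.
have bip : form_bnd ip 1 ip.
  by move=> x y; rewrite mul1r; exact: cauchy_schwarz.
have f1 := form_comp_dist (sesquilinear_ip hip) ler01 q0 d0 bip hd bX bX' hd.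
have f2 := form_comp_dist (sesquilinear_ip hip) ler01 q0 N0 bip bN bY bY' bN.
have : bnd (q * d + q * N) (fun z => Y z - Y' z).
  apply: (form_bnd_operator hip); first by rewrite addr_ge0 ?mulr_ge0.
  move=> x y; have := form_bndD f1 f2 x y => /=.
  have -> : ip (X x) (X y) - ip (X' x) (X' y) + (ip (Y x) (Y y) - ip (Y' x) (Y' y))
     = 2%:R%:C * ip (Y x - Y' x) y.
    rewrite ipBl // mulrBr rmorph_nat eY eY'; ring.
  rewrite cmodM cmodR ger0_norm // => h.
  have e : (1 * (d * q + q * d) + 1 * (N * q + q * N)) * nm x * nm y
    = 2 * ((q * d + q * N) * nm x * nm y) by ring.
  by move: h; rewrite e ler_pM2l.
move=> /(opnorm_le hip (addr_ge0 (mulr_ge0 q0 d0) (mulr_ge0 q0 N0))).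
rewrite -/N => hN; apply: bnd_le bN; rewrite ler_pdivlMr //.
have : q * d <= d by rewrite ler_piMl // ltW.
by lra.
Qed.

Lemma defect_exists : exists Delta : (Z -> Z) -> Z -> Z,
  (forall X, in_ball X -> is_linear (Delta X) /\
     forall z z', ip (Delta X z) (Delta X z') = ip z z' - ip (X z) (X z')) /\
  (forall X X' d, in_ball X -> in_ball X' -> 0 <= d -> bnd d (fun z => X z - X' z) ->
     bnd (d / (1 - q)) (fun z => Delta X z - Delta X' z)).
Proof.
(* Outside the ball the value is an arbitrary default, so that Y becomes a total function of X. *)
have ex X : exists Y, in_ball X -> half_defect X Y.
  have [/half_defect_exists[Y hY]|nX] := pselect (in_ball X); first by exists Y.
  by exists X.
have [Y hY] := choice ex; exists (fun X z => z - Y X z); split.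
  move=> X /hY[lY bY sY eY]; split=> [a x y|z z'].
    by rewrite lY scalerBr opprD addrACA.
  rewrite !ipBl // !ipBr //; rewrite -(sY z z'); have := eY z z'; rewrite -sY.
  set a := ip (Y X z) z'; set b := ip (X z) _; set c := ip (Y X (Y X z)) _ => h.
  have -> : b = 2 * a - c by rewrite h; ring.
  by ring.
move=> X X' d hX hX' d0 hd z.
have -> : z - Y X z - (z - Y X' z) = - (Y X z - Y X' z).
  by rewrite !opprB addrC addrA subrK.
rewrite hnormN //; exact: (half_defect_dist hX hX' (hY X hX) (hY X' hX') d0 hd).
Qed.

Lemma iter_linear (X : Z -> Z) j : is_linear X -> is_linear (iter j X).
Proof. by move=> lX; elim: j => // j IH a x y /=; rewrite IH lX. Qed.

Lemma iter_bnd X j : bnd q X -> bnd (q ^+ j) (iter j X).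
Proof.
move=> bX; elim: j => [|j IH] z /=; first by rewrite expr0 mul1r.
by apply: le_trans (bX _) _; rewrite exprS -mulrA ler_wpM2l.
Qed.

(** X^(j+1) - X'^(j+1) = X (X^j - X'^j) + (X - X') X'^j, so the constant is the derivative of q^j;
    for j = 0 the leading factor makes it 0. *)
Lemma iter_dist X X' d j : in_ball X -> in_ball X' -> 0 <= d ->
  bnd d (fun z => X z - X' z) ->
  bnd (j%:R * q ^+ j.-1 * d) (fun z => iter j X z - iter j X' z).
Proof.
move=> [lX bX] [_ bX'] d0 hd; elim: j => [|j IH] z.
  by rewrite subrr hnorm0 // !mul0r.
have -> : iter j.+1 X z - iter j.+1 X' z
    = X (iter j X z - iter j X' z) + (X (iter j X' z) - X' (iter j X' z)).
  by rewrite /= (linB _ _ lX) addrA subrK.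
apply: le_trans (hnormD hip _ _) _.
apply: le_trans (lerD (bX _) (hd _)) _ => /=.
apply: le_trans (lerD (ler_wpM2l q0 (IH z)) (ler_wpM2l d0 (iter_bnd j bX' z))) _.
rewrite le_eqVlt; apply/orP; left; apply/eqP.
case: j {IH} => [|j]; first by rewrite !expr0; ring.
by rewrite /= !exprS -[j.+2%:R]natr1; ring.
Qed.

Section Model.
Variables (Delta : (Z -> Z) -> Z -> Z) (m : nat).
Hypothesis hDelta : forall X, in_ball X -> is_linear (Delta X) /\
  forall z z', ip (Delta X z) (Delta X z') = ip z z' - ip (X z) (X z').
Hypothesis dDelta : forall X X' d, in_ball X -> in_ball X' -> 0 <= d ->
  bnd d (fun z => X z - X' z) ->
  bnd (d / (1 - q)) (fun z => Delta X z - Delta X' z).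

(* The components of the isometry [z |-> (Delta X^j z)_j] which turns X into a
   compression of the shift, cut off after [m.+1] terms by the last component. *)
Definition model X j z :=
  if (j <= m)%N then Delta X (iter j X z) else iter m.+1 X z.

Lemma model_linear X j : in_ball X -> is_linear (model X j).
Proof.
move=> hX; have [lD _] := hDelta hX; have [lX _] := hX.
by rewrite /model => a x y; case: ifP => _; rewrite iter_linear ?lD.
Qed.

Lemma defect_bnd X : in_ball X -> bnd 1 (Delta X).
Proof.
move=> hX z; have [_ hD] := hDelta hX.
rewrite mul1r -(@ler_pXn2r _ 2) ?nnegrE ?hnorm_ge0 //.
by rewrite hnorm_sqr // hD !ipxx //= gerBl sqr_ge0.
Qed.

Lemma iter_bnd1 X j : bnd q X -> bnd 1 (iter j X).
Proof.
by move=> bX; apply: (bnd_le _ (iter_bnd j bX)); rewrite exprn_ile1 // ltW.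
Qed.

Lemma model_bnd X j : in_ball X -> bnd 1 (model X j).
Proof.
move=> hX z; rewrite /model; case: ifP => _; last exact: (iter_bnd1 m.+1 hX.2).
apply: le_trans (defect_bnd hX _) _; rewrite mul1r; exact: iter_bnd1 hX.2 _.
Qed.

Lemma defect_telescope X n z z' : in_ball X ->
  \sum_(j < n) ip (Delta X (iter j X z)) (Delta X (iter j X z'))
    = ip z z' - ip (iter n X z) (iter n X z').
Proof.
move=> hX; have [_ hD] := hDelta hX.
elim: n => [|n IH]; first by rewrite big_ord0 /= subrr.
by rewrite big_ord_recr /= IH hD; ring.
Qed.

Lemma model_isometry X z z' : in_ball X ->
  \sum_(j < m.+2) ip (model X j z) (model X j z') = ip z z'.
Proof.
move=> hX; rewrite big_ord_recr /=.
have hl w : model X m.+1 w = iter m.+1 X w by rewrite /model ltnn.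
rewrite !hl; under eq_bigr => j _ do rewrite /model -ltnS ltn_ord.
by rewrite defect_telescope // subrK.
Qed.

Definition shift_form X z z' :=
  \sum_(j < m.+2) ip (model X (j.+1 %% m.+2) z) (model X j z').

Definition remainder X z z' :=
  ip (iter m.+1 X z) (Delta X (iter m X z')) + ip (Delta X z) (iter m.+1 X z')
  - ip (iter m.+1 X z) (iter m X z').

(** The terms with j < m telescope to <X z, z'> - <X^(m+1) z, X^m z'>. The passage to the last
    component and the wrap-around give the other two terms of [remainder]; each of the three
    contains a factor X^(m+1). *)
Lemma shift_formE X z z' : in_ball X ->
  shift_form X z z' = ip (X z) z' + remainder X z z'.
Proof.
move=> hX; rewrite /shift_form big_ord_recr big_ord_recr /= modnn.
rewrite [(m.+1 %% _)%N]modn_small //.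
have hl w : model X m.+1 w = iter m.+1 X w by rewrite /model ltnn.
rewrite !hl /model leqnn /=.
under eq_bigr => j _.
  rewrite modn_small; last by rewrite !ltnS (leq_trans (ltnW (ltn_ord j))).
  rewrite ltn_ord (ltnW (ltn_ord j)) iterSr; over.
by rewrite (defect_telescope _ _ _ hX) -iterSr /remainder /=; ring.
Qed.

(** The first summand comes from the defect operator, the second from the powers of X. It grows with
    m, which is harmless: it is only multiplied by q^(m+1), or by a tolerance chosen after m. *)
Definition model_lip : R := (1 - q)^-1 + m.+1%:R.

(** In each of the three terms of [remainder], either the power X^(m+1) varies or it stays as a
    factor q^(m+1); the constant is small for large m. *)
Definition remainder_lip : R :=
  3 * (m.+1%:R * q ^+ m + q ^+ m.+1 * model_lip).

Lemma model_dist X X' d j : in_ball X -> in_ball X' -> 0 <= d ->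
  bnd d (fun z => X z - X' z) ->
  bnd (model_lip * d) (fun z => model X j z - model X' j z).
Proof.
move=> hX hX' d0 hd z; rewrite /model /model_lip.
have q1' : 0 <= (1 - q)^-1 by rewrite invr_ge0 subr_ge0 ltW.
have it k : (k <= m.+1)%N -> nm (iter k X z - iter k X' z) <= m.+1%:R * d * nm z.
  move=> km; apply: le_trans (iter_dist k hX hX' d0 hd z) _.
  rewrite ler_wpM2r ?hnorm_ge0 // ler_wpM2r // -[leRHS]mulr1.
  by apply: ler_pM; rewrite ?exprn_ge0 ?ler_nat // exprn_ile1 // ltW.
case: ifP => [jm|_]; last first.
  apply: le_trans (it _ (leqnn _)) _; rewrite ler_wpM2r ?hnorm_ge0 //.
  by rewrite ler_wpM2r // lerDr.
have [lD _] := hDelta hX.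
have -> : Delta X (iter j X z) - Delta X' (iter j X' z)
  = Delta X (iter j X z - iter j X' z)
    + (Delta X (iter j X' z) - Delta X' (iter j X' z)).
  by rewrite (linB _ _ lD) addrA subrK.
apply: le_trans (hnormD hip _ _) _.
have h1 := defect_bnd hX (iter j X z - iter j X' z).
have h2 := dDelta hX hX' d0 hd (iter j X' z).
have h3 := it j (leqW jm); have h4 := iter_bnd1 j hX'.2 z.
have h5 : d / (1 - q) * nm (iter j X' z) <= d / (1 - q) * nm z.
  by rewrite ler_wpM2l ?mulr_ge0 //; move: h4; rewrite mul1r.
move: h1 h2 h5 => /= h1 h2 h5.
rewrite mulrDl mulrDl [(1 - q)^-1 * d]mulrC; lra.
Qed.

Lemma model_lip_ge : 0 <= (1 - q)^-1 /\ m.+1%:R <= model_lip.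
Proof.
have h : 0 <= (1 - q)^-1 by rewrite invr_ge0 subr_ge0 ltW.
by split=> //; rewrite lerDr.
Qed.

Lemma remainder_dist X X' d : in_ball X -> in_ball X' -> 0 <= d ->
  bnd d (fun z => X z - X' z) ->
  form_bnd ip (remainder_lip * d) (fun z z' => remainder X z z' - remainder X' z z').
Proof.
move=> hX hX' d0 hd; have sip := sesquilinear_ip hip.
have [q1' mL] := model_lip_ge; have L0 := le_trans (ler0n R m.+1) mL.
have bip : form_bnd ip 1 ip.
  by move=> x y; rewrite mul1r; exact: cauchy_schwarz.
have qm0 : 0 <= q ^+ m.+1 by rewrite exprn_ge0.
have dI := iter_dist m.+1 hX hX' d0 hd.
have dI0 : 0 <= m.+1%:R * q ^+ m.+1.-1 * d by rewrite !mulr_ge0 // exprn_ge0.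
have Ld : 0 <= model_lip * d by rewrite mulr_ge0.
have m0 Y w : model Y 0 w = Delta Y w by [].
have mm Y w : model Y m w = Delta Y (iter m Y w) by rewrite /model leqnn.
have bI' := iter_bnd m.+1 hX'.2; have bI := iter_bnd m.+1 hX.2.
have f1 := form_comp_dist sip ler01 qm0 dI0 bip dI (model_bnd m hX) bI'
  (model_dist m hX hX' d0 hd).
have f2 := form_comp_dist sip ler01 ler01 Ld bip (model_dist 0 hX hX' d0 hd) bI
  (model_bnd 0 hX') dI.
have f3 : form_bnd ip (1 * (m.+1%:R * q ^+ m.+1.-1 * d * 1 + q ^+ m.+1 * (model_lip * d)))
    (fun z z' => ip (iter m.+1 X z) (iter m X z') - ip (iter m.+1 X' z) (iter m X' z')).
  apply: form_comp_dist sip ler01 qm0 dI0 bip dI (iter_bnd1 m hX.2) bI' _.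
  apply: bnd_le (iter_dist m hX hX' d0 hd); rewrite ler_wpM2r //.
  apply: le_trans mL; rewrite -[leRHS]mulr1.
  by apply: ler_pM; rewrite ?exprn_ge0 ?ler_nat // exprn_ile1 // ltW.
have f := form_bndD (form_bndD f1 f2) (form_bndN f3).
apply: (form_bnd_le (c := _ + _ + _) _ _); last first.
  move=> x y; have := f x y; rewrite !mm !m0 /remainder.
  by congr (cmod _ <= _); ring.
by rewrite /remainder_lip le_eqVlt; apply/orP; left; apply/eqP => /=; ring.
Qed.

Lemma remainder0 z z' : remainder (fun=> 0) z z' = 0.
Proof.
have hX : in_ball (fun=> 0).
  split=> [a x y|w]; first by rewrite scaler0 addr0.
  by rewrite hnorm0 // mulr_ge0 // hnorm_ge0.
by rewrite /remainder /= !(ip0l hip) !(ip0r hip) addr0 subr0.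
Qed.


End Model.

End Defect.

(** * Solving for the contraction *)

Section SesquilinearClosure.
Variables (R : realType) (V : lmodType R[i]).
Implicit Types (F G : V -> V -> R[i]).

Lemma sesquilinearB F G : sesquilinear F -> sesquilinear G ->
  sesquilinear (fun x y => F x y - G x y).
Proof. by move=> [f1 f2] [g1 g2]; split=> a x y z; rewrite ?f1 ?g1 ?f2 ?g2; ring. Qed.

Lemma sesquilinearZ F a : sesquilinear F -> sesquilinear (fun x y => a * F x y).
Proof. by move=> [f1 f2]; split=> b x y z; rewrite ?f1 ?f2; ring. Qed.

Lemma sesquilinear_comp F (P Q : V -> V) : sesquilinear F -> is_linear P -> is_linear Q ->
  sesquilinear (fun x y => F (P x) (Q y)).
Proof. by move=> [f1 f2] lP lQ; split=> a x y z; rewrite ?lP ?lQ ?f1 ?f2. Qed.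

Lemma sesquilinear_sum n (F : 'I_n -> V -> V -> R[i]) :
  (forall i, sesquilinear (F i)) -> sesquilinear (fun x y => \sum_(i < n) F i x y).
Proof.
move=> hF; split=> a x y z; rewrite mulr_sumr -big_split; apply: eq_bigr => i _ /=.
  by have [-> _] := hF i.
by have [_ ->] := hF i.
Qed.

End SesquilinearClosure.

(* [T X] stands for the components of an isometry which compresses r times the
   cyclic shift of n copies of Z to r X up to [rem X]; the forms F are a
   perturbation of the shift, and X is found as a fixed point. *)
Section Solver.
Variables (R : realType) (Z : lmodType R[i]) (ip : Z -> Z -> R[i]).
Hypothesis hZ : separable_hilbert ip.
Local Notation nm := (hnorm ip).
Local Notation bnd := (bnd ip ip).
Variables (q : R) (q0 : 0 <= q) (q1 : q < 1).
Variables (n : nat) (T : (Z -> Z) -> nat -> Z -> Z) (L K : R).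
Variable rem : (Z -> Z) -> Z -> Z -> R[i].
Hypotheses (L0 : 0 <= L) (K0 : 0 <= K).
Hypothesis lT : forall X j, in_ball ip q X -> is_linear (T X j).
Hypothesis bT : forall X j, in_ball ip q X -> bnd 1 (T X j).
Hypothesis dT : forall X X' j (d : R), in_ball ip q X -> in_ball ip q X' -> 0 <= d ->
  bnd d (fun z => X z - X' z) -> bnd (L * d) (fun z => T X j z - T X' j z).
Hypothesis shiftT : forall X z z', in_ball ip q X ->
  \sum_(j < n) ip (T X (j.+1 %% n) z) (T X j z') = ip (X z) z' + rem X z z'.
Hypothesis drem : forall X X' (d : R), in_ball ip q X -> in_ball ip q X' -> 0 <= d ->
  bnd d (fun z => X z - X' z) ->
  form_bnd ip (K * d) (fun z z' => rem X z z' - rem X' z z').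
Hypothesis rem0 : forall z z', rem (fun=> 0) z z' = 0.
(** The error budget sigma is granted once to the deviation of F from the shift and once to the
    remainder of the model. With total error 2 sigma, the third inequality gives contraction factor
    1/2 and the fourth keeps the iteration in the ball of radius q. *)
Variables (r rho eps sigma : R).
Hypotheses (r0 : 0 < r) (eps0 : 0 <= eps).
Hypothesis hsigma1 : n%:R * (n%:R * (eps * (2 * L + 1))) <= sigma.
Hypothesis hsigma2 : r * K <= sigma.
Hypothesis hsigma3 : 2 * sigma <= r / 2.
Hypothesis hsigma4 : rho + 2 * sigma <= r * q.
Let hip : inner_product_axioms ip. Proof. by case: hZ. Qed.

Implicit Types (F : nat -> nat -> Z -> Z -> R[i]) (X D : Z -> Z).

Definition near_shift F :=
  forall j j', (j < n)%N -> (j' < n)%N -> sesquilinear (F j j') /\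
    form_bnd ip eps
      (fun x y => F j j' x y - (r * (j == j'.+1 %% n)%N%:R)%:C * ip x y).

Definition compression F X (z z' : Z) : R[i] :=
  \sum_(j < n) \sum_(j' < n) F j j' (T X j z) (T X j' z').

Let E F j j' x y : R[i] :=
  F j j' x y - (r * (j == j'.+1 %% n)%N%:R)%:C * ip x y.
(** With this excess over the main term, the equation to solve reads r X = D - g X, and X is a fixed
    point of (D - g X) / r. *)
Let g F X z z' := compression F X z z' - r%:C * ip (X z) z'.

Let sigma0 : 0 <= sigma. Proof. by apply: le_trans hsigma2; rewrite mulr_ge0 // ltW. Qed.

Lemma excessE F X z z' : in_ball ip q X -> g F X z z' =
  \sum_(j < n) \sum_(j' < n) E F j j' (T X j z) (T X j' z') + r%:C * rem X z z'.
Proof.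
move=> hX; rewrite /g /compression /E.
under [in RHS]eq_bigr do rewrite sumrB.
rewrite sumrB [X in _ - X + _]exchange_big /=.
have -> : \sum_(j' < n) \sum_(j < n)
    (r * (nat_of_ord j == j'.+1 %% n)%N%:R)%:C * ip (T X j z) (T X j' z')
  = r%:C * \sum_(j' < n) ip (T X (j'.+1 %% n) z) (T X j' z').
  rewrite mulr_sumr; apply: eq_bigr => j' _.
  have n0 : (0 < n)%N by apply: leq_ltn_trans (ltn_ord j').
  have hj : (j'.+1 %% n < n)%N by rewrite ltn_mod.
  rewrite (bigD1 (Ordinal hj)) //= eqxx mulr1 big1 ?addr0 // => i.
  by rewrite -(inj_eq val_inj) /= => /negPf ->; rewrite mulr0 mul0r.
by rewrite shiftT //; ring.
Qed.

Lemma perturbation_sesquilinear F j j' : near_shift F -> (j < n)%N -> (j' < n)%N ->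
  sesquilinear (E F j j').
Proof.
move=> hF hj hj'; have [sF _] := hF j j' hj hj'.
by apply: sesquilinearB => //; apply: sesquilinearZ; exact: sesquilinear_ip.
Qed.

Lemma compression_sesquilinear F X : near_shift F -> in_ball ip q X ->
  sesquilinear (compression F X).
Proof.
move=> hF hX; apply: sesquilinear_sum => j; apply: sesquilinear_sum => j'.
have [sF _] := hF j j' (ltn_ord j) (ltn_ord j').
exact: (sesquilinear_comp sF (lT j hX) (lT j' hX)).
Qed.

Lemma excess_dist F X X' d : near_shift F -> in_ball ip q X -> in_ball ip q X' ->
  0 <= d -> bnd d (fun z => X z - X' z) ->
  form_bnd ip (2 * sigma * d) (fun z z' => g F X z z' - g F X' z z').
Proof.
move=> hF hX hX' d0 hd.
have f1 (j j' : 'I_n) := form_comp_dist (perturbation_sesquilinear hF (ltn_ord j) (ltn_ord j'))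
  eps0 ler01 (mulr_ge0 L0 d0) (hF j j' (ltn_ord j) (ltn_ord j')).2
  (dT j hX hX' d0 hd) (bT j' hX) (bT j hX') (dT j' hX hX' d0 hd).
have f := form_bndD (form_bnd_sum (fun j => form_bnd_sum (f1 j)))
  (form_bndZ (r%:C) (drem hX hX' d0 hd)).
have hc : n%:R * (n%:R * (eps * (L * d * 1 + 1 * (L * d)))) + cmod r%:C * (K * d)
    <= 2 * sigma * d.
  rewrite cmodR gtr0_norm //.
  have -> : n%:R * (n%:R * (eps * (L * d * 1 + 1 * (L * d))))
    = n%:R * (n%:R * (eps * (2 * L))) * d by ring.
  have : n%:R * (n%:R * (eps * (2 * L))) * d <= sigma * d.
    rewrite ler_wpM2r //; apply: le_trans hsigma1.
    by rewrite !ler_wpM2l // lerDl.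
  have : r * K * d <= sigma * d by rewrite ler_wpM2r.
  by rewrite mulrA; lra.
apply: (form_bnd_le hc) => x y; have := f x y => /=.
rewrite !excessE //; congr (cmod _ <= _).
rewrite opprD addrACA -mulrBr -sumrB; congr (_ + _).
by apply: eq_bigr => j _; rewrite sumrB.
Qed.

Lemma in_ball0 : in_ball ip q (fun=> 0).
Proof.
split=> [a x y|w]; first by rewrite scaler0 addr0.
by rewrite hnorm0 // mulr_ge0 // hnorm_ge0.
Qed.

Lemma excess_bnd F X : near_shift F -> in_ball ip q X ->
  form_bnd ip (2 * sigma) (g F X).
Proof.
move=> hF hX.
have f1 (j j' : 'I_n) : form_bnd ip eps (fun z z' => E F j j' (T X j z) (T X j' z')).
  move=> x y; apply: le_trans ((hF j j' (ltn_ord j) (ltn_ord j')).2 _ _) _.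
  have := bT j hX x; have := bT j' hX y; rewrite !mul1r -!mulrA => h1 h2.
  by rewrite ler_wpM2l // ler_pM // hnorm_ge0.
have hd : bnd q (fun z => X z - 0) by move=> z; rewrite subr0; exact: hX.2.
have f := form_bndD (form_bnd_sum (fun j => form_bnd_sum (f1 j)))
  (form_bndZ (r%:C) (drem hX in_ball0 q0 hd)).
have hc : n%:R * (n%:R * eps) + cmod r%:C * (K * q) <= 2 * sigma.
  rewrite cmodR gtr0_norm //.
  have : n%:R * (n%:R * eps) <= sigma.
    apply: le_trans hsigma1; rewrite !ler_wpM2l //.
    by rewrite -[leLHS]mulr1 ler_wpM2l // lerDr mulr_ge0.
  have : r * K * q <= r * K by rewrite ler_piMr ?mulr_ge0 // ltW.
  by have := hsigma2; rewrite mulrA; lra.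
apply: (form_bnd_le hc) => x y; have := f x y => /=.
by rewrite excessE // rem0 subr0.
Qed.

Lemma compression_solver F D : near_shift F -> is_linear D -> bnd rho D ->
  exists2 X, in_ball ip q X & forall z z', compression F X z z' = ip (D z) z'.
Proof.
move=> hF lD bD; have [_ cZ _] := hZ.
have rC : r%:C != 0 :> R[i].
  by rewrite -[0]/(0%:C) (inj_eq (fmorph_inj _)) gt_eqF.
have cr : cmod (r^-1)%:C = r^-1 :> R by rewrite cmodR ger0_norm // invr_ge0 ltW.
have ex X : exists Y, in_ball ip q X -> in_ball ip q Y /\
    forall z z', ip (Y z) z' = (r^-1)%:C * (ip (D z) z' - g F X z z').
  have [hX|nX] := pselect (in_ball ip q X); last by exists X.
  pose B z z' := (r^-1)%:C * (ip (D z) z' - g F X z z').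
  have sB : sesquilinear B.
    apply: sesquilinearZ; apply: sesquilinearB.
      by apply: (@sesquilinear_comp _ _ ip D id) => //; exact: sesquilinear_ip.
    apply: sesquilinearB; first exact: compression_sesquilinear.
    apply: sesquilinearZ; apply: (@sesquilinear_comp _ _ ip X id) => //.
      exact: sesquilinear_ip.
    by case: hX.
  have bB : form_bnd ip q B.
    have fD : form_bnd ip rho (fun z z' => ip (D z) z').
      move=> x y; apply: le_trans (cauchy_schwarz hip _ _) _.
      by rewrite ler_wpM2r ?hnorm_ge0 //; exact: bD.
    have f := form_bndZ (r^-1)%:C (form_bndD fD (form_bndN (excess_bnd hF hX))).
    apply: form_bnd_le f; rewrite cr mulrC ler_pdivrMr //.
    by rewrite [q * r]mulrC; exact: hsigma4.
  have [Y [lY bY hY]] := @sesquilinear_operator _ _ _ ip _ hZ B q q0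
    sB.1 (fun a w z z' => sB.2 a z z' w) bB.
  by exists Y => _; split.
have [Psi hPsi] := choice ex.
have [| | | | |X hX fX] := @contraction_fixed_point _ _ _ hip cZ (in_ball ip q) Psi
    (fun=> 0) 2^-1 q _ _ q0 in_ball0 (fun X hX => (hPsi X hX).1).
- by rewrite invr_ge0.
- by rewrite invf_lt1 // ltr1n.
- move=> X X' d d0 hX hX' hd.
  apply: (form_bnd_operator hip); first by rewrite mulr_ge0 // invr_ge0.
  have f := form_bndZ (r^-1)%:C (form_bndN (excess_dist hF hX hX' d0 hd)).
  apply: (@form_bnd_le _ _ _ _ (cmod (r^-1)%:C * (2 * sigma * d))).
    rewrite cr mulrA ler_wpM2r // mulrC ler_pdivrMr // [_ * r]mulrC.
    exact: hsigma3.
  move=> x y; have := f x y; rewrite (ipBl hip) (hPsi X hX).2 (hPsi X' hX').2.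
  by congr (cmod _ <= _); ring.
- move=> u X hu cu; split.
    by apply: (linear_limit hip (u := u)) => // i; case: (hu i).
  by apply: (bnd_limit hip (u := u)) => // i; case: (hu i).
- by move=> z; rewrite subr0; exact: (hPsi _ in_ball0).1.2.
exists X => // z z'; have := (hPsi X hX).2 z z'; rewrite fX /g rmorphV ?unitfE ?gt_eqF //.
move=> h; have : r%:C * ip (X z) z' = ip (D z) z' - (compression F X z z' - r%:C * ip (X z) z').
  by rewrite {1}h mulrA mulfV // mul1r.
move=> {}h; apply/eqP; rewrite -subr_eq0; apply/eqP.
have -> : compression F X z z' - ip (D z) z' = - (ip (D z) z' -
  (compression F X z z' - r%:C * ip (X z) z')) + r%:C * ip (X z) z' by ring.
by rewrite -h; ring.
Qed.

(** For the norm N of X - X', the equations give r N <= eta + 2 sigma N + n^2 eta, and 2 sigma <= r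
    / 2 absorbs the middle term. The case eta = 0 is uniqueness; hence solutions picked separately
    at each time still form a continuous path. *)
Lemma compression_solver_stable F F' D D' X X' eta : 0 <= eta ->
  near_shift F -> near_shift F' ->
  (forall j j', (j < n)%N -> (j' < n)%N ->
     form_bnd ip eta (fun x y => F j j' x y - F' j j' x y)) ->
  bnd eta (fun z => D z - D' z) -> in_ball ip q X -> in_ball ip q X' ->
  (forall z z', compression F X z z' = ip (D z) z') ->
  (forall z z', compression F' X' z z' = ip (D' z) z') ->
  bnd (2 / r * (n%:R * n%:R + 1) * eta) (fun z => X z - X' z).
Proof.
move=> eta0 hF hF' hFF' hDD' hX hX' eX eX'.
have bo : bounded_op ip ip (fun z => X z - X' z).
  by apply: bounded_op_sub => //; split; try (by case: hX); try (by case: hX');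
    exists q; [case: hX|case: hX'].
have bN := bounded_opP hip hip bo; have N0 := opnorm_ge0 hip hip bo.
set N := opnorm _ _ _ in bN N0.
have f1 : form_bnd ip eta (fun z z' => ip (D z - D' z) z').
  move=> x y; apply: le_trans (cauchy_schwarz hip _ _) _.
  by rewrite ler_wpM2r ?hnorm_ge0 //; exact: hDD'.
have f2 := form_bndN (excess_dist hF hX hX' N0 bN).
have f3 : form_bnd ip (n%:R * (n%:R * eta)) (fun z z' =>
    \sum_(j < n) \sum_(j' < n) (F j j' (T X' j z) (T X' j' z')
       - F' j j' (T X' j z) (T X' j' z'))).
  apply: form_bnd_sum => j; apply: form_bnd_sum => j' x y.
  apply: le_trans (hFF' j j' (ltn_ord j) (ltn_ord j') _ _) _.
  have := bT j hX' x; have := bT j' hX' y; rewrite !mul1r -!mulrA => h1 h2.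
  by rewrite ler_wpM2l // ler_pM // hnorm_ge0.
have f := form_bndZ (r^-1)%:C (form_bndD (form_bndD f1 f2) (form_bndN f3)).
have cr : cmod (r^-1)%:C = r^-1 :> R by rewrite cmodR ger0_norm // invr_ge0 ltW.
have rC : r%:C != 0 :> R[i].
  by rewrite -[0]/(0%:C) (inj_eq (fmorph_inj _)) gt_eqF.
set c := cmod _ * _ in f.
have c0 : 0 <= c.
  rewrite /c mulr_ge0 ?cmod_ge0 //.
  by rewrite !addr_ge0 ?mulr_ge0.
have : bnd c (fun z => X z - X' z).
  apply: (form_bnd_operator hip) => // x y; have := f x y.
  congr (cmod _ <= _); rewrite rmorphV ?unitfE ?gt_eqF //=.
  have -> : \sum_(j < n) \sum_(j' < n) (F j j' (T X' j x) (T X' j' y)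
       - F' j j' (T X' j x) (T X' j' y)) = compression F X' x y - ip (D' x) y.
    rewrite -eX' /compression -sumrB; apply: eq_bigr => j _; exact: sumrB.
  rewrite (ipBl hip (D x)) (ipBl hip (X x)) /g (eX x y).
  move: (compression F X' x y) => c1.
  move: (ip (D x) y) (ip (D' x) y) (ip (X x) y) (ip (X' x) y) => c2 c3 c4 c5.
  by field.
move=> /(opnorm_le hip c0); rewrite -/N => hN; apply: bnd_le bN.
have : N * r <= eta + 2 * sigma * N + n%:R * (n%:R * eta).
  by rewrite -ler_pdivlMr // mulrC -cr.
have : 2 * sigma * N <= r / 2 * N by rewrite ler_wpM2r.
have -> : 2 / r * (n%:R * n%:R + 1) * eta = (2 * ((n%:R * n%:R + 1) * eta)) / r.
  by field; rewrite gt_eqF.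
by rewrite ler_pdivlMr //; lra.
Qed.

End Solver.

(** All constants are produced before A, D and H appear, from Z, r and rho alone; the cover of [0,1]
    and the vectors in H can then be adapted to eps. *)
Lemma universal_model (R : realType) (Z : lmodType R[i]) (ip : Z -> Z -> R[i])
    (hZ : separable_hilbert ip) (r rho : R) : 0 <= rho -> rho < r ->
  exists (n : nat) (T : (Z -> Z) -> nat -> Z -> Z) (eps q L C : R),
  [/\ (0 < n)%N, 0 < eps, 0 <= L & 0 <= C] /\
  [/\ forall X j, in_ball ip q X -> is_linear (T X j) /\ bnd ip ip 1 (T X j),
   forall X z z', in_ball ip q X ->
     \sum_(j < n) ip (T X j z) (T X j z') = ip z z',
   forall X X' j (d : R), in_ball ip q X -> in_ball ip q X' -> 0 <= d ->
     bnd ip ip d (fun z => X z - X' z) ->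
     bnd ip ip (L * d) (fun z => T X j z - T X' j z),
   forall F D, near_shift ip n r eps F -> is_linear D -> bnd ip ip rho D ->
     exists2 X, in_ball ip q X &
       forall z z', compression n T F X z z' = ip (D z) z' &
   forall F F' D D' X X' eta, 0 <= eta ->
     near_shift ip n r eps F -> near_shift ip n r eps F' ->
     (forall j j', (j < n)%N -> (j' < n)%N ->
       form_bnd ip eta (fun x y => F j j' x y - F' j j' x y)) ->
     bnd ip ip eta (fun z => D z - D' z) -> in_ball ip q X -> in_ball ip q X' ->
     (forall z z', compression n T F X z z' = ip (D z) z') ->
     (forall z z', compression n T F' X' z z' = ip (D' z) z') ->
     bnd ip ip (C * eta) (fun z => X z - X' z)].
Proof.
move=> rho0 rhor; have r0 : 0 < r by apply: le_lt_trans rhor.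
(* q is midway between rho / r and 1, and sigma is such that rho + 2 sigma = r q exactly. *)
pose q := (1 + rho / r) / 2; pose sigma := (r - rho) / 4.
have rr0 : 0 <= rho / r by rewrite divr_ge0 // ltW.
have rr1 : rho / r < 1 by rewrite ltr_pdivrMr // mul1r.
have q0 : 0 <= q by rewrite /q; lra.
have q1 : q < 1 by rewrite /q; lra.
have s0 : 0 < sigma by rewrite /sigma; lra.
have rq : rho + 2 * sigma <= r * q.
  have : r * (rho / r) = rho by rewrite mulrC divfK // gt_eqF.
  by rewrite /q /sigma; lra.
have s3 : 2 * sigma <= r / 2 by rewrite /sigma; lra.
have iq0 : 0 <= (1 - q)^-1 by rewrite invr_ge0 subr_ge0 ltW.
(* [remainder_lip q m] is at most B (m+1) q^m, so m is chosen to make the latter smaller than sigma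
   / r. *)
pose B := 3 * (2 + (1 - q)^-1); have B0 : 0 < B by rewrite /B; lra.
have rB : 0 < r * B by exact: mulr_gt0.
have [m hm] := geometric_derivative_small q0 q1 (divr_gt0 s0 rB).
have {}hm := hm m (leqnn m); rewrite ltr_pdivlMr // in hm.
have [Delta [hD dD]] := defect_exists hZ q0 q1.
have [_ mL] := model_lip_ge (q := q) q1 m.
have L0 : 0 <= model_lip q m := le_trans (ler0n R m.+1) mL.
have x0 : 0 <= q ^+ m by rewrite exprn_ge0.
have K0 : 0 <= remainder_lip q m.
  by rewrite /remainder_lip mulr_ge0 // addr_ge0 // mulr_ge0 // exprn_ge0.
have s2 : r * remainder_lip q m <= sigma.
  apply: le_trans (ltW hm); rewrite [_ * (r * B)]mulrCA ler_wpM2l ?(ltW r0) //.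
  rewrite /remainder_lip /model_lip /B exprS.
  have m1 : 1 <= m.+1%:R :> R by rewrite ler1n.
  have : q * q ^+ m <= q ^+ m by rewrite ler_piMl // ltW.
  set x := q ^+ m in x0 *; set M := m.+1%:R in m1 *; set y := (1 - q)^-1 in iq0 * => h.
  have : q * x * (y + M) <= M * x * y + M * x.
    rewrite mulrDr lerD //; last by rewrite [M * x]mulrC ler_wpM2r // (le_trans _ m1).
    rewrite ler_wpM2r // (le_trans h) // -[leLHS]mul1r ler_wpM2r //.
  by lra.
(* With m fixed, eps = sigma / W shares sigma among the (m+2)^2 blocks of the form. *)
pose L := model_lip q m; pose W := m.+2%:R * m.+2%:R * (2 * L + 1).
have W0 : 0 < W by rewrite !mulr_gt0 ?ltr0Sn // ltr_wpDl // mulr_ge0.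
pose eps := sigma / W; have eps0 : 0 < eps by rewrite divr_gt0.
have s1 : m.+2%:R * (m.+2%:R * (eps * (2 * L + 1))) <= sigma.
  have -> : m.+2%:R * (m.+2%:R * (eps * (2 * L + 1))) = eps * W by rewrite /W; ring.
  by rewrite /eps divfK // gt_eqF.
exists m.+2, (model Delta m), eps, q, L, (2 / r * (m.+2%:R * m.+2%:R + 1)).
split; first by split=> //; rewrite mulr_ge0 ?divr_ge0 ?(ltW r0) // addr_ge0 // mulr_ge0.
have lT X j hX := model_linear m hD j (X := X) hX.
have bT X j hX := model_bnd hZ q0 q1 m hD j (X := X) hX.
have dT X X' j d hX hX' d0 hd :=
  model_dist hZ q0 q1 m hD dD j (X := X) (X' := X') (d := d) hX hX' d0 hd.
have sh X z z' hX := shift_formE m hD z z' (X := X) hX.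
have dr X X' d hX hX' d0 hd :=
  remainder_dist hZ q0 q1 m hD dD (X := X) (X' := X') (d := d) hX hX' d0 hd.
have re0 := remainder0 hZ q0 Delta m.
split.
- by move=> X j hX; split; [exact: lT|exact: bT].
- by move=> X z z' hX; exact: model_isometry hX.
- exact: dT.
- move=> F D hF lD bD.
  exact: (compression_solver hZ q0 q1 L0 K0 lT bT dT sh dr re0 r0 (ltW eps0)
    s1 s2 s3 rq hF lD bD).
- move=> F F' D D' X X' eta eta0 hF hF' hFF' hDD' hX hX' eX eX'.
  exact: (compression_solver_stable hZ L0 K0 bT dT sh dr r0
    (ltW eps0) s1 s2 s3 eta0 hF hF' hFF' hDD' hX hX' eX eX').
Qed.

Lemma conjcM (R : realType) (a b : R[i]) : (a * b)^* = a^* * b^*.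
Proof. exact: rmorphM. Qed.

Lemma conjcX (R : realType) (a : R[i]) k : (a ^+ k)^* = a^* ^+ k.
Proof. exact: rmorphXn. Qed.

(** * Compressing a finite family of operators to the shift *)

Section RootsOfUnity.
Variable R : realType.

Lemma primitive_root_exists n : (0 < n)%N -> exists w : R[i], n.-primitive_root w.
Proof.
move=> n0; pose p : {poly R[i]} := 'X^n - 1.
have [s Dp] := closed_field_poly_normal p.
rewrite (monicP _) ?monicXnsubC // scale1r in Dp.
have s1 : all n.-unity_root s by apply/allP => z; rewrite -root_prod_XsubC -Dp.
have sz : (n < (size s).+1)%N.
  by rewrite -(size_prod_XsubC s id) -Dp size_XnsubC.
have [|z] := hasP (has_prim_root n0 s1 _ sz); last by exists z.
by rewrite -separable_prod_XsubC -Dp separable_Xn_sub_1 // pnatr_eq0 -lt0n.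
Qed.

Lemma unit_root_conj n (w : R[i]) : (0 < n)%N -> w ^+ n = 1 ->
  cmod w = 1 /\ w * w^* = 1.
Proof.
move=> n0 wn; have h : cmod w = 1.
  apply/eqP; rewrite -(@pexpr_eq1 _ (cmod w) n) ?cmod_ge0 // -cmodX wn.
  by rewrite cmod1.
by rewrite mulcJ h expr1n.
Qed.

Lemma roots_of_unity_orthogonal n (w : R[i]) a b : n.-primitive_root w ->
  \sum_(c < n) (w ^+ a * w^* ^+ b) ^+ c = if (a == b %[mod n])%N then n%:R else 0.
Proof.
move=> pw; have n0 := prim_order_gt0 pw; have wn := prim_expr_order pw.
have [_ ww] := unit_root_conj n0 wn.
have w0 : w != 0 by apply/eqP => w0; move: ww; rewrite w0 mul0r => /eqP; rewrite eq_sym oner_eq0.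
have -> : w^* = w^-1 by apply: (mulfI w0); rewrite ww mulfV.
rewrite -(eq_prim_root_expr pw); case: eqP => [->|/eqP ab].
  rewrite exprVn mulfV ?expf_neq0 //.
  by under eq_bigr do rewrite expr1n; rewrite sumr_const card_ord.
have z1 : w ^+ a * w^-1 ^+ b != 1.
  apply: contra ab => /eqP h; apply/eqP.
  by rewrite -[LHS]mulr1 -(mulVf (expf_neq0 b w0)) mulrA -exprVn h mul1r.
apply: (mulfI (_ : w ^+ a * w^-1 ^+ b - 1 != 0)); first by rewrite subr_eq0.
rewrite mulr0 -subrX1 exprMn -!exprM !(mulnC _ n) !exprM exprVn wn.
by rewrite invr1 !expr1n mulr1 subrr.
Qed.

End RootsOfUnity.

Section ShiftFamily.
Variables (R : realType) (Z H : lmodType R[i]).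
Variables (ipZ : Z -> Z -> R[i]) (ipH : H -> H -> R[i]).
Hypotheses (hZ : separable_hilbert ipZ) (hH : separable_hilbert ipH).
Variables (I : finType) (A : I -> H -> H) (r : R).
Hypothesis bA : forall i, bounded_op ipH ipH (A i).
Hypothesis r0 : 0 <= r.
Hypothesis disc : forall i l, cmod l <= r -> ess_num_range ipH (A i) l.

(* The discrete Fourier transform turns diagonal compressions with entries
   [r w^(-c)] into r times the cyclic shift. *)
Lemma shift_family n eta : (0 < n)%N -> 0 < eta -> exists V : I -> nat -> Z -> H,
  [/\ forall i j, is_linear (V i j),
   forall i i' j j' z z', (j < n)%N -> (j' < n)%N ->
     ipH (V i j z) (V i' j' z') = ((i == i') && (j == j'))%:R * ipZ z z' &
   forall l i i' j j', (j < n)%N -> (j' < n)%N -> (i == i' -> l = i) ->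
     form_bnd ipZ eta (fun z z' => ipH (A l (V i j z)) (V i' j' z')
       - (i == i')%:R * ((r * (j == j'.+1 %% n)%N%:R)%:C * ipZ z z'))].
Proof.
move=> n0 eta0; have [iZ cZ sZ] := hZ; have [iH cH sH] := hH.
have [w pw] := primitive_root_exists R n0; have wn := prim_expr_order pw.
have [w1 ww] := unit_root_conj n0 wn.
have nR : 0 < n%:R :> R by rewrite ltr0n.
have nC : n%:R != 0 :> R[i] by rewrite pnatr_eq0 -lt0n.
pose lam (p : I * 'I_n) := r%:C * w^* ^+ p.2.
have hl p : ess_num_range ipH (A p.1) (lam p).
  apply: disc; rewrite cmodM cmodX cmodJ w1 expr1n mulr1 cmodR ger0_norm //.
(* [embedding_form] loses a factor 4; the Fourier sums have n^2 terms of weight 1/n and lose a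
   factor n. *)
have e0 : 0 < eta / (4 * n%:R) by rewrite divr_gt0 // mulr_gt0.
have [u [ou hu]] := select_family iH bA hl e0.
have [e he] := hilbert_basis_exists iZ sZ.
have [U hU] := embeddings_exist iZ iH cH he ou.
have lU p : is_linear (U p) := embedding_linear iZ iH hU p.
have oU p p' z z' := embedding_ip iZ iH he ou hU p p' z z'.
(* The unitary Fourier matrix. Weighting its row products by the diagonal entries, which are r times
   conj (w)^c, raises the index j' by one, and orthogonality of the roots of unity leaves r exactly
   when j = j' + 1 modulo n. *)
pose a j c := ((Num.sqrt n%:R)^-1)%:C * w ^+ (c * j) : R[i].
have aa j j' c : a j c * (a j' c)^* = n%:R^-1 * (w ^+ j * w^* ^+ j') ^+ c.
  rewrite /a conjcM conjcX conjc_real mulrACA -rmorphM -invfM -expr2.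
  rewrite sqr_sqrtr ?ltW // fmorphV rmorph_nat; congr (_ * _).
  by rewrite exprMn -!exprM ![(c * _)%N]mulnC.
have ca j c : cmod (a j c) = (Num.sqrt n%:R)^-1.
  by rewrite /a cmodM cmodX w1 expr1n mulr1 cmodR ger0_norm // invr_ge0 sqrtr_ge0.
exists (fun i j z => \sum_(c < n) a j c *: U (i, c) z); split.
- move=> i j b x y; rewrite scaler_sumr -big_split; apply: eq_bigr => c _ /=.
  by rewrite lU scalerDr !scalerA mulrC.
- move=> i i' j j' z z' jn jn'.
  rewrite ip_suml //; under eq_bigr => c _.
    rewrite ip_sumr // (bigD1 c) //= big1 ?addr0 => [|c' cc']; last first.
      by rewrite ipZl // ipZr // oU xpair_eqE [c == c']eq_sym (negPf cc') andbF mul0r !mulr0.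
    rewrite ipZl // ipZr // oU xpair_eqE eqxx andbT mulrA aa; over.
  rewrite -mulr_suml -mulr_sumr roots_of_unity_orthogonal //.
  rewrite !modn_small // -mulnb natrM; case: eqP => _; last by rewrite !mulr0 !mul0r.
  by rewrite mulVf // mul1r mulr1.
move=> l i i' j j' jn jn' hl' z z'.
have -> : (i == i')%:R * ((r * (j == j'.+1 %% n)%N%:R)%:C * ipZ z z') =
  \sum_(c < n) \sum_(c' < n) (a j c * (a j' c')^*)
     * (((i, c) == (i', c'))%:R * lam (i, c) * ipZ z z').
  under eq_bigr => c _.
    rewrite (bigD1 c) //= big1 ?addr0 => [|c' cc']; last first.
      by rewrite xpair_eqE [c == c']eq_sym (negPf cc') andbF !mul0r mulr0.
    rewrite xpair_eqE eqxx andbT aa /lam /=.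
    rewrite (_ : _ * _ = (i == i')%:R * r%:C * n%:R^-1 * ipZ z z'
      * (w ^+ j * w^* ^+ j'.+1) ^+ c); first over.
    by rewrite !exprMn -!exprM [w^* ^+ (j'.+1 * c)]exprM exprS exprMn -exprM; ring.
  rewrite -mulr_sumr roots_of_unity_orthogonal // [(j %% n)%N]modn_small //.
  rewrite rmorphM /= rmorph_nat; case: (@eqP _ j (j'.+1 %% n)%N) => _ /=; last by rewrite mulr0n !(mulr0, mul0r).
  by field.
rewrite (lin_sum _ _ _ (bA l).1).
rewrite ip_suml //; under [X in cmod (X - _)]eq_bigr => c _.
  rewrite ip_sumr //; under eq_bigr => c' _.
    rewrite (linZ _ _ (bA l).1).
    rewrite ipZl // ipZr // mulrA; over.
  over.
rewrite -sumrB; apply: le_trans (cmod_sum _ _ _) _.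
have -> : eta * hnorm ipZ z * hnorm ipZ z' = \sum_(c < n) \sum_(c' < n)
   n%:R^-1 * (4 * (eta / (4 * n%:R)) * hnorm ipZ z * hnorm ipZ z').
  rewrite !sumr_const !card_ord -!mulrnA -[RHS]mulr_natl natrM; field.
  by rewrite pnatr_eq0 -lt0n.
apply: ler_sum => c _; rewrite -sumrB; apply: le_trans (cmod_sum _ _ _) _.
apply: ler_sum => c' _; rewrite -mulrBr cmodM [cmod (a j c * _)]cmodM cmodJ !ca.
rewrite -invfM -expr2 sqr_sqrtr ?(ltW nR) // ler_wpM2l ?invr_ge0 ?(ltW nR) //.
have [alpha _ hal] := common_bound bA.
apply: (embedding_form iZ iH he hU (b := fun p p' => (p == p')%:R * lam p)
  (bA l).1 (hal l) (ltW e0)) => k k'.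
apply: hu; rewrite xpair_eqE => /andP[/hl' -> _] //.
Qed.

End ShiftFamily.

(** * Gluing along the path *)

Section Glue.
Variables (R : realType) (Z H : lmodType R[i]).
Variables (ipZ : Z -> Z -> R[i]) (ipH : H -> H -> R[i]).
Hypotheses (iZ : inner_product_axioms ipZ) (iH : inner_product_axioms ipH).
Variables (I : finType) (A : I -> H -> H) (r eta : R) (n : nat).
Variable V : I -> nat -> Z -> H.
Hypothesis lV : forall i j, is_linear (V i j).
Hypothesis oV : forall i i' j j' z z', (j < n)%N -> (j' < n)%N ->
  ipH (V i j z) (V i' j' z') = ((i == i') && (j == j'))%:R * ipZ z z'.
Hypothesis fV : forall l i i' j j', (j < n)%N -> (j' < n)%N -> (i == i' -> l = i) ->
  form_bnd ipZ eta (fun z z' => ipH (A l (V i j z)) (V i' j' z')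
    - (i == i')%:R * ((r * (j == j'.+1 %% n)%N%:R)%:C * ipZ z z')).
Hypothesis lA : forall i, is_linear (A i).

Definition glue (phi : I -> R) j z := \sum_i (phi i)%:C *: V i j z.

Lemma glue_linear phi j : is_linear (glue phi j).
Proof.
move=> a x y; rewrite /glue scaler_sumr -big_split; apply: eq_bigr => i _ /=.
by rewrite lV scalerDr !scalerA mulrC.
Qed.

Lemma embedding_norm i j z : (j < n)%N -> hnorm ipH (V i j z) = hnorm ipZ z.
Proof. by move=> jn; rewrite /hnorm oV // !eqxx mul1r. Qed.

Lemma glue_dist phi psi j z (nu : R) : (j < n)%N ->
  \sum_i `|phi i - psi i| <= nu ->
  hnorm ipH (glue phi j z - glue psi j z) <= nu * hnorm ipZ z.
Proof.
move=> jn h; rewrite /glue -sumrB; apply: le_trans (hnorm_sum iH _ _ _) _.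
apply: le_trans (ler_wpM2r (hnorm_ge0 _ _) h); rewrite mulr_suml.
apply: ler_sum => i _; rewrite -scalerBl -rmorphB hnormZ // cmodR.
by rewrite embedding_norm.
Qed.

Variable phi : I -> R.
Hypothesis phi0 : forall i, 0 <= phi i.
Hypothesis phi1 : \sum_i phi i ^+ 2 = 1.

Lemma glue_ip j j' z z' : (j < n)%N -> (j' < n)%N ->
  ipH (glue phi j z) (glue phi j' z') = (j == j')%:R * ipZ z z'.
Proof.
move=> jn jn'; rewrite /glue ip_suml //.
under eq_bigr => i _.
  rewrite ip_sumr // (bigD1 i) //= big1 ?addr0 => [|i' ii']; last first.
    by rewrite ipZl // ipZr // oV // eq_sym (negPf ii') mul0r !mulr0.
  rewrite ipZl // ipZr // oV // eqxx andTb conjc_real mulrA -rmorphM -expr2; over.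
by rewrite -mulr_suml -rmorph_sum phi1 mul1r.
Qed.

Lemma glue_norm j z : (j < n)%N -> hnorm ipH (glue phi j z) = hnorm ipZ z.
Proof. by move=> jn; rewrite /hnorm glue_ip // eqxx mul1r. Qed.

Lemma phi_le1 i : phi i <= 1.
Proof.
rewrite -(@ler_pXn2r _ 2) ?nnegrE // expr1n -phi1 (bigD1 i) //= lerDl.
by apply: sumr_ge0 => k _; exact: sqr_ge0.
Qed.

(* The cross terms between different indices are small for every [A l], so that
   At may be replaced by any single [A i0] which is close to it. *)
Lemma glue_form (At : H -> H) (eps : R) j j' : is_linear At -> 0 <= eps -> 0 <= eta ->
  (forall i, phi i != 0 -> bnd ipH ipH eps (fun x => At x - A i x)) ->
  #|I|%:R * (#|I|%:R * eta) <= eps -> (j < n)%N -> (j' < n)%N ->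
  form_bnd ipZ (4 * eps) (fun z z' => ipH (At (glue phi j z)) (glue phi j' z')
    - (r * (j == j'.+1 %% n)%N%:R)%:C * ipZ z z').
Proof.
move=> lAt eps0 eta0 hAt hI jn jn' z z'.
have [i0 hi0] : exists i0, phi i0 != 0.
  apply: contrapT => h; move: phi1; rewrite big1 => [/esym/eqP|i _].
    by rewrite oner_eq0.
  have [->|nz] := eqVneq (phi i) 0; first by rewrite expr0n.
  by case: h; exists i.
set c := (r * _)%:C; set nz := hnorm ipZ z; set nz' := hnorm ipZ z'.
have nn : 0 <= nz * nz' by rewrite mulr_ge0 ?hnorm_ge0.
pose E x := At x - A i0 x.
have -> : ipH (At (glue phi j z)) (glue phi j' z') - c * ipZ z z' =
    ipH (E (glue phi j z)) (glue phi j' z') +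
    (ipH (A i0 (glue phi j z)) (glue phi j' z') - c * ipZ z z').
  by rewrite /E ipBl //; ring.
apply: le_trans (cmodD _ _) _.
have h1 : cmod (ipH (E (glue phi j z)) (glue phi j' z')) <= eps * (nz * nz').
  apply: le_trans (cauchy_schwarz iH _ _) _; rewrite glue_norm // mulrA.
  rewrite ler_wpM2r ?hnorm_ge0 //; apply: le_trans (hAt i0 hi0 _) _.
  by rewrite glue_norm.
pose G i i' := ipH (A i0 (V i j z)) (V i' j' z') - (i == i')%:R * (c * ipZ z z').
have eG : ipH (A i0 (glue phi j z)) (glue phi j' z') - c * ipZ z z'
    = \sum_i \sum_i' (phi i * phi i')%:C * G i i'.
  have -> : c * ipZ z z' = \sum_i \sum_i' (phi i * phi i')%:C
      * ((i == i')%:R * (c * ipZ z z')).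
    under eq_bigr => i _.
      rewrite (bigD1 i) //= big1 ?addr0 => [|i' ii']; last first.
        by rewrite eq_sym (negPf ii') mul0r mulr0.
      rewrite eqxx mul1r -expr2; over.
    by rewrite -mulr_suml -rmorph_sum phi1 mul1r.
  rewrite /glue (lin_sum _ _ _ (lA i0)) ip_suml // -sumrB; apply: eq_bigr => i _.
  rewrite ip_sumr // -sumrB; apply: eq_bigr => i' _.
  by rewrite (linZ _ _ (lA i0)) ipZl // ipZr // conjc_real /G rmorphM mulrBr mulrA.
(* For i = i' with phi i nonzero, A i and A i0 are both within eps of At, hence 2 eps apart. Since
   the squares of phi sum to 1, the total is eps for replacing At, 2 eps for the diagonal, and at
   most eps for all errors eta together. *)
have h2 i i' : cmod ((phi i * phi i')%:C * G i i')
    <= (i == i')%:R * phi i ^+ 2 * (2 * eps * (nz * nz')) + eta * (nz * nz').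
  rewrite cmodM cmodR ger0_norm ?mulr_ge0 //.
  have p1 : phi i * phi i' <= 1 by rewrite mulr_ile1 // phi_le1.
  have p0 : 0 <= phi i * phi i' by rewrite mulr_ge0.
  have [ii|ii] := eqVneq i i'; last first.
    have hl : i == i' -> i0 = i by rewrite (negPf ii).
    have := fV jn jn' hl z z'; rewrite -/c -/nz -/nz' -/(G i i') -mulrA => h.
    rewrite !mul0r add0r; apply: le_trans h.
    by rewrite ler_piMl ?cmod_ge0.
  rewrite -ii mul1r -expr2; have [p|p] := eqVneq (phi i) 0.
    by rewrite p expr0n /= !mul0r add0r mulr_ge0.
  have q1 : phi i ^+ 2 <= 1 by rewrite expr_le1 // phi_le1.
  have := fV jn jn' (fun _ => erefl i) z z' (i' := i).
  rewrite -/c -/nz -/nz' eqxx mul1r -mulrA => h.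
  have -> : G i i = (ipH (A i (V i j z)) (V i j' z') - c * ipZ z z')
     + ipH ((At (V i j z) - A i (V i j z)) - (At (V i j z) - A i0 (V i j z))) (V i j' z').
    by rewrite /G eqxx mul1r !(ipBl iH); ring.
  have h3 : cmod (ipH ((At (V i j z) - A i (V i j z))
       - (At (V i j z) - A i0 (V i j z))) (V i j' z')) <= 2 * eps * (nz * nz').
    apply: le_trans (cauchy_schwarz iH _ _) _; rewrite embedding_norm // mulrA.
    rewrite ler_wpM2r ?hnorm_ge0 //; apply: le_trans (hnormB iH _ _) _.
    have := hAt i p (V i j z); have := hAt i0 hi0 (V i j z).
    by rewrite !embedding_norm // -/nz; lra.
  have h4 := le_trans (cmodD _ _) (lerD h h3).
  apply: le_trans (ler_wpM2l (sqr_ge0 _) h4) _; rewrite mulrDr addrC lerD2l.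
  by rewrite ler_piMl // mulr_ge0.
have h3 : cmod (\sum_i \sum_i' (phi i * phi i')%:C * G i i')
    <= 2 * eps * (nz * nz') + #|I|%:R * (#|I|%:R * eta) * (nz * nz').
  apply: le_trans (cmod_sum _ _ _) _.
  apply: (@le_trans _ _ (\sum_i (phi i ^+ 2 * (2 * eps * (nz * nz'))
      + #|I|%:R * (eta * (nz * nz'))))).
    apply: ler_sum => i _; apply: le_trans (cmod_sum _ _ _) _.
    apply: le_trans (ler_sum _ (fun i' _ => h2 i i')) _.
    rewrite big_split /= sumr_const -[X in _ + X]mulr_natl lerD2r.
    rewrite (bigD1 i) //= eqxx mul1r big1 ?addr0 // => i' ii'.
    by rewrite eq_sym (negPf ii') !mul0r.
  rewrite big_split /= -mulr_suml phi1 mul1r sumr_const -[X in _ + X]mulr_natl.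
  by rewrite lerD2l !mulrA.
rewrite -mulrA -/nz -/nz' eG.
have : #|I|%:R * (#|I|%:R * eta) * (nz * nz') <= eps * (nz * nz') by rewrite ler_wpM2r.
move: h1 h3; set X1 := nz * nz'; set X2 := cmod _; set X3 := cmod _; lra.
Qed.

End Glue.

(** * Compactness of the interval, the disc inside the range, and the weights *)

Section Interval.
Variable R : realType.
Implicit Types t x : R.

(** Heine-Borel for a gauge d: let y run over the points for which [0,y] has a finite cover. The
    ball about the supremum of these y reaches beyond it unless the supremum is 1. *)
Lemma unit_interval_cover (d : R -> R) :
  (forall t, 0 <= t <= 1 -> 0 < d t) ->
  exists s : seq R, (forall x, x \in s -> 0 <= x <= 1) /\
    forall t, 0 <= t <= 1 -> exists2 x, x \in s & `|t - x| < d x.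
Proof.
move=> d0.
pose covers y (s : seq R) := (forall x, x \in s -> 0 <= x <= 1) /\
  forall t, 0 <= t <= y -> exists2 x, x \in s & `|t - x| < d x.
pose P := [set y : R | 0 <= y <= 1 /\ exists s, covers y s].
have P0 : P 0.
  split; first by rewrite lexx ler01.
  exists [:: 0]; split=> [x|t]; first by rewrite inE => /eqP ->; rewrite lexx ler01.
  rewrite -eq_le => /eqP <-; exists 0; rewrite ?inE // subrr normr0 d0 //.
  by rewrite lexx ler01.
have supP : has_sup P by split; [exists 0|exists 1 => y [/andP[]]].
have s0 : 0 <= sup P by apply: ub_le_sup => //; case: supP.
have s1 : sup P <= 1 by apply: ge_sup => [|y [/andP[]]] //; exists 0.
have s01 : 0 <= sup P <= 1 by rewrite s0 s1.
have [y [hy [s [hs cs]]] ys] := sup_adherent (d0 _ s01) supP.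
(* Half the radius keeps z strictly inside the open ball about the supremum. *)
pose z := Num.min 1 (sup P + d (sup P) / 2).
have dP := d0 _ s01.
have cz : covers z (sup P :: s).
  split=> [x|t /andP[t0 tz]]; first by rewrite inE => /predU1P[->|/hs].
  have [ty|ty] := leP t y.
    have [|x xs hx] := cs t; first by rewrite t0 ty.
    by exists x; rewrite ?inE ?xs ?orbT.
  exists (sup P); rewrite ?mem_head // ltr_norml.
  have : z <= sup P + d (sup P) / 2 by rewrite ge_min lexx orbT.
  by move=> hz; apply/andP; split; lra.
have z1 : z <= 1 by rewrite ge_min lexx.
have Pz : P z.
  split; last by exists (sup P :: s).
  by rewrite z1 andbT le_min ler01 addr_ge0 // divr_ge0 // ltW.
have zs : z <= sup P by apply: ub_le_sup => //; case: supP.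
have z1' : z = 1.
  by move: zs; rewrite /z minElt; case: ifP => // _; lra.
by exists (sup P :: s); move: cz; rewrite z1'.
Qed.

End Interval.

(** If l were outside S, the last point on the segment from 0 to l adherent to its part in S would
    be a boundary point of modulus at most |l|. For an empty boundary [dist0] is 0 and the
    hypothesis cannot hold. *)
Lemma disc_sub_ess_num_range (R : realType) (S : set R[i]) (l : R[i]) :
  S 0 -> cmod l < dist0 (cboundary S) -> S l.
Proof.
move=> S0 hl; apply: contrapT => Sl.
pose P := [set s : R | 0 <= s <= 1 /\ S (s%:C * l)].
have P0 : P 0 by split; rewrite ?lexx ?ler01 // mul0r.
have hP : has_sup P by split; [exists 0|exists 1 => y [/andP[]]].
have s0 : 0 <= sup P by apply: ub_le_sup => //; case: hP.
have s1 : sup P <= 1 by apply: ge_sup => [|y [/andP[]]] //; exists 0.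
have dl a b : cmod (a%:C * l - b%:C * l) = `|a - b| * cmod l.
  by rewrite -mulrBl cmodM -rmorphB cmodR.
have l1 : 0 < cmod l + 1 by have := cmod_ge0 l; lra.
have hb : cboundary S ((sup P)%:C * l).
  move=> e e0; have e1 : 0 < e / (cmod l + 1) by rewrite divr_gt0.
  have key a : `|a - sup P| < e / (cmod l + 1) ->
      cmod (a%:C * l - (sup P)%:C * l) < e.
    rewrite dl ltr_pdivlMr //; apply: le_lt_trans.
    by rewrite ler_wpM2l // lerDl.
  split.
    have [y [hy Sy] ys] := sup_adherent e1 hP.
    have yP : y <= sup P by apply: ub_le_sup; [case: hP|split].
    by exists (y%:C * l) => //; apply: key; rewrite ltr_norml; apply/andP; split; lra.
  have [sl|sl] := ltP (sup P) 1; last first.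
    have -> : sup P = 1 by apply/eqP; rewrite eq_le s1.
    by exists l => //; rewrite mul1r subrr cmod0.
  pose y := Num.min 1 (sup P + e / (cmod l + 1) / 2).
  have ys : sup P < y by rewrite lt_min sl ltrDl divr_gt0.
  exists (y%:C * l).
    move=> Sy; have : y <= sup P.
      apply: ub_le_sup; first by case: hP.
      by split=> //; rewrite ge_min lexx andbT (le_trans s0) // ltW.
    by rewrite leNgt ys.
  apply: key; have : y <= sup P + e / (cmod l + 1) / 2 by rewrite ge_min lexx orbT.
  by move=> h; rewrite ger0_norm ?subr_ge0 ?ltW //; lra.
have : dist0 (cboundary S) <= cmod ((sup P)%:C * l).
  apply: ge_inf; last by exists ((sup P)%:C * l).
  by exists 0 => _ [x _ <-]; exact: cmod_ge0.
rewrite leNgt => /negP; apply; apply: le_lt_trans hl.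
by rewrite cmodM cmodR ger0_norm // ler_piMl ?cmod_ge0.
Qed.

Section Weights.
Variables (R : realType) (I : finType) (x d : I -> R).

Definition hat i (t : R) : R := Num.max 0 (d i - `|t - x i|).

Definition weight (t : R) i : R := hat i t / Num.sqrt (\sum_j hat j t ^+ 2).

Lemma hat_ge0 i t : 0 <= hat i t.
Proof. by rewrite le_max lexx. Qed.

Lemma hat_gt0 i t : (0 < hat i t) = (`|t - x i| < d i).
Proof. by rewrite lt_max ltxx subr_gt0. Qed.

Lemma hat_continuous i : continuous (hat i).
Proof.
move=> t; apply/cvgrPdist_lt => e e0; near=> s.
have st : `|t - s| < e by near: s; exact: cvgr_dist_lt.
apply: le_lt_trans st.
have h1 : `|t - x i| <= `|s - x i| + `|t - s|.
  have := ler_normD (s - x i) (t - s); rewrite [s - x i + _]addrC addrA subrK.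
  by [].
have h2 : `|s - x i| <= `|t - x i| + `|t - s|.
  have := ler_normD (t - x i) (s - t); rewrite [t - x i + _]addrC addrA subrK.
  by rewrite [`|s - t|]distrC.
rewrite /hat ler_norml /Num.max; have := normr_ge0 (t - s).
by case: ltP => a; case: ltP => b c; apply/andP; split; lra.
Unshelve. all: by end_near. Qed.

Lemma weight_ge0 t i : 0 <= weight t i.
Proof. by rewrite divr_ge0 ?hat_ge0 ?sqrtr_ge0. Qed.

Lemma weight_support t i : weight t i != 0 -> `|t - x i| < d i.
Proof.
rewrite -hat_gt0 lt_neqAle hat_ge0 andbT => w0.
by apply/eqP => h; move: w0; rewrite /weight -h mul0r eqxx.
Qed.

Variable t : R.
Hypothesis covered : exists i, `|t - x i| < d i.

Lemma hat_sum_gt0 : 0 < \sum_j hat j t ^+ 2.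
Proof.
have [i hi] := covered; rewrite (bigD1 i) //= ltr_pwDl ?exprn_gt0 ?hat_gt0 //.
by apply: sumr_ge0 => j _; exact: sqr_ge0.
Qed.

Lemma weight_sum : \sum_i weight t i ^+ 2 = 1.
Proof.
under eq_bigr do rewrite exprMn exprVn sqr_sqrtr ?(ltW hat_sum_gt0) //.
by rewrite -mulr_suml mulfV // gt_eqF // hat_sum_gt0.
Qed.

Lemma weight_near (e : R) : 0 < e -> exists2 dl : R, 0 < dl &
  forall s, `|s - t| < dl -> \sum_i `|weight s i - weight t i| < e.
Proof.
move=> e0.
have cw i : weight s i @[s --> t] --> weight t i.
  apply: cvgM; first exact: hat_continuous.
  apply: cvgV; first by rewrite gt_eqF // sqrtr_gt0 hat_sum_gt0.
  apply: continuous_cvg; first exact: sqrt_continuous.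
  apply: cvg_big => [|j _]; first exact: add_continuous.
  by under eq_fun do rewrite expr2; apply: cvgM; exact: hat_continuous.
have cs : \sum_i `|weight s i - weight t i| @[s --> t] --> \sum_(i : I) (0 : R).
  apply: cvg_big => [|i _]; first exact: add_continuous.
  suff : `|weight s i - weight t i| @[s --> t] --> `|weight t i - weight t i|.
    by rewrite subrr normr0.
  by apply: cvg_norm; apply: cvgB; [exact: cw|exact: cvg_cst].
move/cvgrPdist_lt: cs => /(_ e e0) cs.
have [dl /= dl0 hdl] := (nbhs_ballP _ _).1 cs.
exists dl => // s st; have := hdl s; rewrite big1 // sub0r normrN ger0_norm.
  by apply; rewrite /ball /= distrC.
by apply: sumr_ge0.
Qed.

End Weights.

(** * Assembling the isometries and their continuity *)

Section Assembly.
Variables (R : realType) (Z H : lmodType R[i]).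
Variables (ipZ : Z -> Z -> R[i]) (ipH : H -> H -> R[i]).
Hypotheses (iZ : inner_product_axioms ipZ) (iH : inner_product_axioms ipH).
Variable n : nat.

Lemma form_dist (A A' : H -> H) (W W' Y Y' : Z -> H) (alpha th : R) :
  is_linear A -> 0 <= alpha -> 0 <= th -> bnd ipH ipH alpha A ->
  bnd ipH ipH th (fun x => A' x - A x) ->
  (forall z, hnorm ipH (W' z) = hnorm ipZ z) -> (forall z, hnorm ipH (W z) = hnorm ipZ z) ->
  (forall z, hnorm ipH (Y' z) = hnorm ipZ z) ->
  bnd ipZ ipH th (fun z => W' z - W z) -> bnd ipZ ipH th (fun z => Y' z - Y z) ->
  form_bnd ipZ (th * (1 + 2 * alpha))
    (fun z z' => ipH (A' (W' z)) (Y' z') - ipH (A (W z)) (Y z')).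
Proof.
move=> lA a0 th0 bA bA' nW' nW nY' bW bY z z'.
have -> : ipH (A' (W' z)) (Y' z') - ipH (A (W z)) (Y z') =
   ipH (A' (W' z) - A (W' z)) (Y' z') +
   (ipH (A (W' z - W z)) (Y' z') + ipH (A (W z)) (Y' z' - Y z')).
  by rewrite (linB _ _ lA) !(ipBl iH) !(ipBr iH); ring.
set u := hnorm ipZ z; set v := hnorm ipZ z'.
have u0 : 0 <= u by exact: hnorm_ge0.
have v0 : 0 <= v by exact: hnorm_ge0.
have h1 : cmod (ipH (A' (W' z) - A (W' z)) (Y' z')) <= th * u * v.
  apply: le_trans (cauchy_schwarz iH _ _) _; rewrite nY' ler_wpM2r //.
  by apply: le_trans (bA' _) _; rewrite nW'.
have h2 : cmod (ipH (A (W' z - W z)) (Y' z')) <= alpha * (th * u) * v.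
  apply: le_trans (cauchy_schwarz iH _ _) _; rewrite nY' ler_wpM2r //.
  by apply: le_trans (bA _) _; rewrite ler_wpM2l //; exact: bW.
have h3 : cmod (ipH (A (W z)) (Y' z' - Y z')) <= alpha * u * (th * v).
  apply: le_trans (cauchy_schwarz iH _ _) _.
  have hb : hnorm ipH (A (W z)) <= alpha * u by rewrite /u -nW; exact: bA.
  by have hy := bY z'; apply: ler_pM; rewrite ?hnorm_ge0.
apply: le_trans (cmodD _ _) _; apply: le_trans (lerD h1 (cmodD _ _)) _.
apply: le_trans (lerD (lexx _) (lerD h2 h3)) _.
by rewrite le_eqVlt; apply/orP; left; apply/eqP; ring.
Qed.

Lemma sum_isometry (W : nat -> Z -> H) (Q : nat -> Z -> Z) z z' :
  (forall j j' x y, (j < n)%N -> (j' < n)%N ->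
     ipH (W j x) (W j' y) = (j == j')%:R * ipZ x y) ->
  ipH (\sum_(j < n) W j (Q j z)) (\sum_(j < n) W j (Q j z'))
    = \sum_(j < n) ipZ (Q j z) (Q j z').
Proof.
move=> hW; rewrite ip_suml //; apply: eq_bigr => j _.
rewrite ip_sumr // (bigD1 j) //= big1 ?addr0 => [|j' jj'].
  by rewrite hW // eqxx mul1r.
by rewrite hW // [_ == _]eq_sym (negPf (_ : j' != j :> nat)) // mul0r.
Qed.

End Assembly.

Section OperatorPaths.
Variables (R : realType) (K W : lmodType R[i]).
Variables (ipK : K -> K -> R[i]) (ipW : W -> W -> R[i]).
Hypotheses (hK : inner_product_axioms ipK) (hW : inner_product_axioms ipW).
Variables (F : R -> K -> W) (hF : op_path ipK ipW F).

Lemma op_path_near t (e : R) : 0 <= t <= 1 -> 0 < e -> exists2 d : R, 0 < d &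
  forall s, 0 <= s <= 1 -> `|s - t| < d -> bnd ipK ipW e (fun x => F s x - F t x).
Proof.
move=> ht e0; have [bF cF] := hF; have [d d0 hd] := cF t ht e e0.
exists d => // s hs st; apply: (bnd_le (ltW (hd s hs st))).
by apply: bounded_opP => //; apply: bounded_op_sub => //; exact: bF.
Qed.

Lemma op_path_gauge (e : R) : 0 < e -> exists d : R -> R, forall t, 0 <= t <= 1 ->
  0 < d t /\ forall s, 0 <= s <= 1 -> `|s - t| < d t ->
    bnd ipK ipW e (fun x => F s x - F t x).
Proof.
move=> e0; have ex t : exists d : R, 0 <= t <= 1 -> 0 < d /\
    forall s, 0 <= s <= 1 -> `|s - t| < d -> bnd ipK ipW e (fun x => F s x - F t x).
  have [ht|ht] := boolP (0 <= t <= 1); last by exists 0.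
  by have [d d0 hd] := op_path_near ht e0; exists d.
by have [d hd] := choice ex; exists d.
Qed.

(** This makes the supremum of the norms along the path a genuine upper bound. On a finite cover by
    intervals where F moves by at most 1, a sum of the norms at the centres serves in place of their
    maximum. *)
Lemma op_path_bounded :
  has_ubound [set opnorm ipK ipW (F t) | t in [set t : R | 0 <= t <= 1]].
Proof.
have [bF _] := hF; have [d hd] := op_path_gauge ltr01.
have [s [s01 cs]] := unit_interval_cover (fun t ht => (hd t ht).1).
exists (1 + \sum_(x <- s) `|opnorm ipK ipW (F x)|) => _ [t ht <-].
have [x xs tx] := cs t ht; have hx := s01 x xs.
rewrite (big_rem x) //=; set S := \sum_(y <- rem x s) _.
have S0 : 0 <= S by apply: sumr_ge0.
apply: (@le_trans _ _ (1 + opnorm ipK ipW (F x))); last first.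
  by rewrite lerD2l (le_trans (ler_norm _)) // lerDl.
apply: opnorm_le => //; first by rewrite addr_ge0 // opnorm_ge0 //; exact: bF.
move=> y; apply: le_trans (hnorm_dist hW _ (F x y)) _.
rewrite addrC mulrDl lerD //; first exact: ((hd x hx).2 t ht tx y).
by apply: bounded_opP => //; exact: bF.
Qed.

End OperatorPaths.

Unset Implicit Arguments.
Local Close Scope complex_scope.

Theorem theorem1p2 (R : realType)
  (H : lmodType R[i]) (ipH : H -> H -> R[i])
  (hH : separable_hilbert ipH) (infH : infinite_dimensional ipH)
  (A : R -> H -> H) (hA : op_path ipH ipH A)
  (hA0 : forall t : R, 0 <= t <= 1 -> cinterior (ess_num_range ipH (A t)) 0)
  (Z : lmodType R[i]) (ipZ : Z -> Z -> R[i]) (hZ : separable_hilbert ipZ)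
  (D : R -> Z -> Z) (hD : op_path ipZ ipZ D)
  (hDA : sup [set opnorm ipZ ipZ (D t) | t in [set t : R | 0 <= t <= 1]]
         < inf [set dist0 (cboundary (ess_num_range ipH (A t)))
                 | t in [set t : R | 0 <= t <= 1]]) :
  exists S : R -> Z -> H,
    op_path ipZ ipH S /\
    forall t : R, 0 <= t <= 1 ->
      is_isometry ipZ ipH (S t) /\
      exists Sstar : H -> Z, is_adjoint ipZ ipH (S t) Sstar /\
        forall z : Z, Sstar (A t (S t z)) = D t z.
Proof.
have [iH cH sH] := hH; have [iZ cZ sZ] := hZ.
have [bA _] := hA; have [bD _] := hD.
set rho := sup _ in hDA; set dlt := inf _ in hDA.
have t01 : 0 <= (0 : R) <= 1 by rewrite lexx ler01.
have Dle t : 0 <= t <= 1 -> opnorm ipZ ipZ (D t) <= rho.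
  by move=> ht; apply: (ub_le_sup (op_path_bounded iZ iZ hD)); exists t.
have rho0 : 0 <= rho := le_trans (opnorm_ge0 iZ iZ (bD 0 t01)) (Dle 0 t01).
have bDr t : 0 <= t <= 1 -> bnd ipZ ipZ rho (D t).
  by move=> ht; apply: (bnd_le (Dle t ht)); apply: bounded_opP => //; exact: bD.
(* Strictly between the two: r > rho leaves room for a strict contraction X, and r < dlt puts the
   closed disc of radius r inside every range. *)
pose r := (rho + dlt) / 2.
have rr : rho < r by rewrite /r; lra.
have disc t l : 0 <= t <= 1 -> cmod l <= r -> ess_num_range ipH (A t) l.
  move=> ht hl; apply: disc_sub_ess_num_range.
    by have [e e0 he] := hA0 t ht; apply: he; rewrite subrr cmod0.
  apply: (@lt_le_trans _ _ dlt); first by apply: le_lt_trans hl _; rewrite /r; lra.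
  apply: ge_inf; last by exists t.
  (* An infimum is a lower bound only for a set bounded below. Here 0 works in all cases, an empty
     boundary having [dist0] equal to 0 by convention. *)
  exists 0 => _ [u _ <-]; rewrite /dist0.
  have [->|/set0P ne] := eqVneq [set cmod l | l in cboundary
      (ess_num_range ipH (A u))] set0; first by rewrite inf0.
  by apply: lb_le_inf => // _ [l' _ <-]; exact: cmod_ge0.
have [n [T [eps [q [L [C [[n0 eps0 L0 C0] [hT isoT dT solve stab]]]]]]]] :=
  universal_model hZ rho0 rr.
(* Gluing multiplies the tolerance by 4. *)
have e4 : 0 < eps / 4 by rewrite divr_gt0.
have [d hd] := op_path_gauge iH iH hA e4.
have [s [s01 cs]] := unit_interval_cover (fun t ht => (hd t ht).1).
pose I := 'I_(size s); pose x (i : I) := s`_i.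
have x01 i : 0 <= x i <= 1 by apply: s01; exact: mem_nth.
(* At most |I|^2 errors of size eta may add up to eps / 4; the summand 1 guards against a zero
   denominator. *)
pose eta := eps / 4 / (#|I|%:R * #|I|%:R + 1).
have I1 : 0 < #|I|%:R * #|I|%:R + 1 :> R by rewrite ltr_wpDl // mulr_ge0.
have eta0 : 0 < eta by rewrite divr_gt0.
have hI : #|I|%:R * (#|I|%:R * eta) <= eps / 4.
  rewrite mulrA -[leRHS](divfK (lt0r_neq0 I1)) mulrC -/eta ler_wpM2l ?(ltW eta0) //.
  by rewrite lerDl.
have bAx i : bounded_op ipH ipH (A (x i)) by exact: bA.
have r0 : 0 <= r := le_trans rho0 (ltW rr).
have [V [lV oV fV]] := shift_family hZ hH bAx r0
  (fun i l => disc (x i) l (x01 i)) n0 eta0.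
pose phi := weight x (fun i => d (x i)).
have cov t : 0 <= t <= 1 -> exists i, `|t - x i| < d (x i).
  move=> ht; have [y ys ty] := cs t ht.
  have yi : (index y s < size s)%N by rewrite index_mem.
  by exists (Ordinal yi); rewrite /x nth_index.
have phi0 t i : 0 <= phi t i by exact: weight_ge0.
have phi1 t : 0 <= t <= 1 -> \sum_i phi t i ^+ 2 = 1.
  by move=> ht; apply: weight_sum; exact: cov.
pose W t := glue V (phi t).
have lW t j : is_linear (W t j) by exact: glue_linear.
have oW t j j' y z : 0 <= t <= 1 -> (j < n)%N -> (j' < n)%N ->
    ipH (W t j y) (W t j' z) = (j == j')%:R * ipZ y z.
  by move=> ht jn jn'; apply: (glue_ip iH oV (phi1 t ht)).
have nW t j z : 0 <= t <= 1 -> (j < n)%N -> hnorm ipH (W t j z) = hnorm ipZ z.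
  by move=> ht jn; rewrite /hnorm oW // eqxx mul1r.
pose F t j j' z z' := ipH (A t (W t j z)) (W t j' z').
have hF t : 0 <= t <= 1 -> near_shift ipZ n r eps (F t).
  move=> ht j j' jn jn'; have lAt := (bA t ht).1; split.
    split=> a y z z'; rewrite /F; first by rewrite lW lAt ip_lin.
    by rewrite lW ipDr // ipZr.
  have -> : eps = 4 * (eps / 4) by field.
  apply: (glue_form iH oV fV (fun i => (bAx i).1) (phi0 t) (phi1 t ht) lAt
    (ltW e4) (ltW eta0) _ hI jn jn') => i /weight_support hi.
  exact: ((hd (x i) (x01 i)).2 t ht hi).
have exX t : exists X, 0 <= t <= 1 -> in_ball ipZ q X /\
    forall z z', compression n T (F t) X z z' = ipZ (D t z) z'.
  have [ht|ht] := boolP (0 <= t <= 1); last by exists (fun=> 0).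
  by have [X hX eX] := solve _ _ (hF t ht) (bD t ht).1 (bDr t ht); exists X.
(* The choice is made independently at each time; continuity in t will come from the stability
   estimate [stab]. *)
have [X hX] := choice exX.
pose S t z := \sum_(j < n) W t j (T (X t) j z).
have ipS t z z' : 0 <= t <= 1 -> ipH (S t z) (S t z') = ipZ z z'.
  move=> ht; rewrite (sum_isometry (ipZ := ipZ) iH (W := W t) (T (X t))) ?isoT //.
    by case: (hX t ht).
  by move=> j j' y z0 jn jn'; exact: oW.
have lS t : 0 <= t <= 1 -> is_linear (S t).
  move=> ht a y z; rewrite /S scaler_sumr -big_split; apply: eq_bigr => j _ /=.
  by have [lT _] := hT (X t) j (hX t ht).1; rewrite lT lW.
have nS t z : 0 <= t <= 1 -> hnorm ipH (S t z) = hnorm ipZ z.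
  by move=> ht; rewrite /hnorm ipS.
have bS t : 0 <= t <= 1 -> bnd ipZ ipH 1 (S t).
  by move=> ht z; rewrite nS // mul1r.
exists S; split; last first.
  move=> t ht; split; first by move=> z; exact: nS.
  have [Ss [_ _ hSs]] := adjoint_exists iH hZ ler01 (lS t ht) (bS t ht).
  exists Ss; split=> [z y|z]; first exact: hSs.
  apply: (ip_inj iZ) => z'; rewrite hSs -(hX t ht).2 /compression.
  have lAt := (bA t ht).1.
  rewrite {1}/S (lin_sum _ _ _ lAt) ip_suml //; apply: eq_bigr => j _.
  by rewrite /S ip_sumr.
split=> [t ht|t ht e e0]; first exact: bnd_bounded_op (lS t ht) (bS t ht).
pose alpha := opnorm ipH ipH (A t).
have al0 : 0 <= alpha by apply: opnorm_ge0 => //; exact: bA.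
(* If A, D and the weights move by at most th, the forms F move by th (1 + 2 alpha), X by C times
   that, and each component of the model by L times that. Adding the motion of W over the n
   components gives th (M - 1), which is below th (2 M) = e. *)
pose M := n%:R * (1 + L * (C * (1 + 2 * alpha))) + 1.
have M0 : 0 < M by rewrite ltr_wpDl // !mulr_ge0 // !addr_ge0 // !mulr_ge0 // !addr_ge0 // mulr_ge0.
pose th := e / (2 * M); have th0 : 0 < th by rewrite divr_gt0 // mulr_gt0.
have [d1 d10 hd1] := op_path_near iH iH hA ht th0.
have [d2 d20 hd2] := op_path_near iZ iZ hD ht th0.
have [d3 d30 hd3] := weight_near (cov t ht) th0.
exists (Num.min d1 (Num.min d2 d3)); first by rewrite !lt_min d10 d20.
move=> u hu; rewrite !lt_min => /and3P[ut1 ut2 ut3].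
have dW j : (j < n)%N -> bnd ipZ ipH th (fun z => W u j z - W t j z).
  by move=> jn z; apply: (glue_dist iH oV _ jn); exact: ltW (hd3 u ut3).
have dF j j' : (j < n)%N -> (j' < n)%N ->
    form_bnd ipZ (th * (1 + 2 * alpha)) (fun y z => F u j j' y z - F t j j' y z).
  move=> jn jn'; apply: (form_dist iH (bA t ht).1 al0 (ltW th0)) => //.
  - by apply: bounded_opP => //; exact: bA.
  - exact: hd1.
  - by move=> z; exact: nW.
  - by move=> z; exact: nW.
  - by move=> z; exact: nW.
  - exact: dW.
  - exact: dW.
have al1 : 1 <= 1 + 2 * alpha by rewrite lerDl mulr_ge0.
have eta0' : 0 <= th * (1 + 2 * alpha) by rewrite mulr_ge0 ?(ltW th0) // (le_trans _ al1).
have dD : bnd ipZ ipZ (th * (1 + 2 * alpha)) (fun z => D u z - D t z).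
  by apply: (bnd_le _ (hd2 u hu ut2)); rewrite ler_peMr // ltW.
have [hXu eXu] := hX u hu; have [hXt eXt] := hX t ht.
have dX := stab _ _ _ _ _ _ _ eta0' (hF u hu) (hF t ht) dF dD hXu hXt eXu eXt.
have c0 : 0 <= C * (th * (1 + 2 * alpha)) by rewrite mulr_ge0.
have dTX j := dT _ _ j _ hXu hXt c0 dX.
have : bnd ipZ ipH (n%:R * (th + L * (C * (th * (1 + 2 * alpha)))))
    (fun z => S u z - S t z).
  move=> z; rewrite /S -sumrB; apply: le_trans (hnorm_sum iH _ _ _) _.
  rewrite -mulrA mulr_natl -[n in _ *+ n]card_ord -sumr_const.
  apply: ler_sum => j _.
  have -> : W u j (T (X u) j z) - W t j (T (X t) j z) =
     (W u j (T (X u) j z) - W t j (T (X u) j z))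
       + W t j (T (X u) j z - T (X t) j z).
    by rewrite (linB _ _ (lW t j)) addrA subrK.
  apply: le_trans (hnormD iH _ _) _; rewrite nW // mulrDl.
  apply: lerD; last exact: dTX.
  apply: le_trans (dW j (ltn_ord j) _) _; rewrite ler_wpM2l ?(ltW th0) //.
  by have [_ bT] := hT (X u) j hXu; have := bT z; rewrite mul1r.
have cS : 0 <= n%:R * (th + L * (C * (th * (1 + 2 * alpha)))).
  by rewrite mulr_ge0 // addr_ge0 ?(ltW th0) // mulr_ge0.
move=> /(opnorm_le iZ cS) h; apply: le_lt_trans h _.
have -> : n%:R * (th + L * (C * (th * (1 + 2 * alpha)))) = th * (M - 1).
  by rewrite /M; ring.
have -> : e = th * (2 * M) by rewrite /th divfK // gt_eqF // mulr_gt0.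
by rewrite ltr_pM2l //; lra.
Qed.
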